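(* For $0\le\alpha<1$ and $\theta>-\alpha$, each $(\alpha,\theta)$ partition structure has a distributionally unique arrangement as a self-similar Markov composition structure; that is, there exists a self-similar Markov composition structure $(\mathcal C_n)$ such that $(\mathcal C_n^\downarrow)$ is the $(\alpha,\theta)$ partition structure, and the distributions of the $\mathcal C_n$ are uniquely determined by this property.
   Context: A composition of $n$ is a sequence $\lambda=(\lambda_1,\dots,\lambda_\ell)$ of positive integers with sum $n$, and $\lambda^\downarrow$ is its decreasing rearrangement (a partition of $n$). It is represented by a row of $n$ balls in $\ell$ consecutive boxes, the $i$th from the left containing $\lambda_i$ balls, and in binary form by the string of $n$ digits whose $j$th digit is $1$ iff the $j$th ball is leftmost in its box. A composition structure is a sequence $(\mathcal C_n)_{n\ge1}$ of random compositions, $\mathcal C_n$ of $n$, such that for all $n\ge2$ deleting a uniformly random ball from $\mathcal C_n$ (chosen independently of $\mathcal C_n$; an emptied box disappears) gives a composition distributed as $\mathcal C_{n-1}$. An arrangement of a partition structure $(\pi_n)$ as a composition structure is a composition structure $(\mathcal C_n)$ with $\mathcal C_n^\downarrow$ distributed as $\pi_n$ for every $n$. A composition structure $(\mathcal C_n)$ is self-similar Markov if there is a time-homogeneous (strictly) increasing Markov chain $(Q^\uparrow_t,t=0,1,\dots)$ on $\{1,2,\dots\}$ with $Q^\uparrow_0=1$ such that, with $\xi_j=1$ if the chain visits $j$ and $\xi_j=0$ otherwise, $\mathcal C_n$ has for each $n$ the distribution of the composition with binary form $\xi_1\cdots\xi_n$. For $0\le\alpha<1$, $\theta>-\alpha$,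 let $W_1,W_2,\dots$ be independent, $W_i$ having beta$(1-\alpha,\theta+i\alpha)$ distribution, and $\widetilde V_i=(1-W_1)\cdots(1-W_{i-1})W_i$. The $(\alpha,\theta)$ partition structure is the sequence of random partitions $\pi_n$ of $n$, where $\pi_n$ is the decreasing rearrangement of the block sizes obtained when $n$ labels are sampled that are, given $(\widetilde V_i)$, independent with $\mathbb P(\text{label}=i)=\widetilde V_i$, and equal labels are put in the same block. *)

(* Defs.v *)
From HB Require Import structures.
From mathcomp Require Import all_boot all_order all_algebra.
From mathcomp Require Import finmap.
From mathcomp Require Import all_classical all_reals all_analysis.

Set Implicit Arguments.
Unset Strict Implicit.
Unset Printing Implicit Defensive.

Import Order.TTheory GRing.Theory Num.Theory.
Import numFieldNormedType.Exports.

Local Open Scope classical_set_scope.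
Local Open Scope ring_scope.

Definition is_composition (n : nat) (s : seq nat) : bool :=
  all (leq 1) s && (sumn s == n).

Record composition (n : nat) := Composition {
  parts :> seq nat;
  partsP : is_composition n parts
}.

HB.instance Definition _ n := [isSub for @parts n].
HB.instance Definition _ n := [Countable of composition n by <:].

Lemma size_composition n (l : composition n) : (size l <= n)%N.
Proof.
case: l => s /= /andP[hs /eqP <-]; elim: s hs => //= k s IH /andP[k0 /IH hs].
by rewrite -add1n leq_add.
Qed.

Lemma part_le n (l : composition n) : all (fun k => k <= n)%N l.
Proof.
case: l => s /= /andP[_ /eqP <-]; elim: s => //= k s IH.
rewrite leq_addr /=; apply: sub_all IH => j /leq_trans; apply; exact: leq_addl.
Qed.

Definition composition_code n (l : composition n) : n.-bseq 'I_n.+1 :=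
  insub_bseq n [seq inord k | k <- parts l].

Definition composition_decode n (b : n.-bseq 'I_n.+1) : option (composition n) :=
  insub [seq val i | i <- b].

Lemma composition_codeK n :
  pcancel (@composition_code n) (@composition_decode n).
Proof.
move=> l; rewrite /composition_decode /composition_code /insub_bseq.
rewrite insubdK; last by rewrite unfold_in /= size_map size_composition.
rewrite -map_comp (_ : map _ _ = val l) ?valK //.
rewrite -[RHS]map_id; apply/eq_in_map => k kl /=.
by rewrite inordK // ltnS; exact: (allP (part_le l)).
Qed.

HB.instance Definition _ n :=
  fintype.isFinite.Build (composition n) (pcan_enumP (@composition_codeK n)).

(* Digits of the balls, box by box: a box of k balls contributes 1 0 ... 0. *)
Definition binary_form (s : seq nat) : seq bool :=
  flatten [seq true :: nseq k.-1 false | k <- s].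

Definition ranked (s : seq nat) : seq nat := sort geq s.

(* Balls are numbered from 0, from left to right. *)
Fixpoint delete_ball (s : seq nat) (j : nat) : seq nat :=
  if s is k :: s' then
    if (j < k)%N then (if k == 1%N then s' else k.-1 :: s')
    else k :: delete_ball s' (j - k)
  else [::].

Section Structures.
Variable R : realType.

Definition is_pmf (T : finType) (p : T -> R) : Prop :=
  (forall x, 0 <= p x) /\ \sum_x p x = 1.

(* C n is the probability mass function of the random composition of n; the
   value at n = 0 is irrelevant throughout. *)
Definition composition_structure (C : forall n, composition n -> R) : Prop :=
  (forall n, (1 <= n)%N -> is_pmf (C n)) /\
  (forall n, (2 <= n)%N -> forall mu : composition n.-1,
     C n.-1 mu =
       \sum_(l : composition n)
          C n l * (#|[set j : 'I_n | delete_ball l j == mu]%SET|%:R / n%:R)).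

(* pi n lam is the probability that the n-th random partition, written as a
   weakly decreasing sequence, equals lam. *)
Definition is_arrangement (pi : nat -> seq nat -> R)
    (C : forall n, composition n -> R) : Prop :=
  composition_structure C /\
  forall n, (1 <= n)%N -> forall lam : seq nat,
    \sum_(l : composition n | ranked l == lam) C n l = pi n lam.

Section Probability.
Context d (T : measurableType d) (P : probability T R).

(* p is the transition matrix on {1,2,...}; values of p at 0 are irrelevant. *)
Definition increasing_markov_chain (Q : nat -> {RV P >-> nat})
    (p : nat -> nat -> R) : Prop :=
  [/\ forall i j, (0 < i)%N -> (0 < j)%N -> 0 <= p i j,
      forall i, (0 < i)%N -> (\sum_(1 <= j <oo) (p i j)%:E = 1)%E,
      {ae P, forall w, Q 0%N w = 1%N},
      {ae P, forall w, forall t, (Q t w < Q t.+1 w)%N} &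
      forall t (x : nat -> nat),
        (forall s, (s <= t.+1)%N -> (0 < x s)%N) ->
        P [set w | forall s, (s <= t.+1)%N -> Q s w = x s] =
        (P [set w | forall s, (s <= t)%N -> Q s w = x s]
          * (p (x t) (x t.+1))%:E)%E].

Definition visits (Q : nat -> {RV P >-> nat}) (w : T) (j : nat) : bool :=
  `[< exists t, Q t w = j >].

Definition mutually_independent (W : nat -> {RV P >-> R}) : Prop :=
  forall (J : {fset nat}) (A : nat -> set R), (forall i, measurable (A i)) ->
    P (\bigcap_(i in [set` J]) (W i @^-1` A i)) =
    (\prod_(i <- J) P (W i @^-1` A i))%E.

Definition beta_weight (a b x : R) : R := x `^ (a - 1) * (1 - x) `^ (b - 1).

(* The library's beta_prob only covers integer parameters. *)
Definition has_beta_law (a b : R) (X : {RV P >-> R}) : Prop :=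
  forall A : set R, measurable A ->
    distribution P X A =
    (\int[lebesgue_measure]_(x in A `&` `]0%R, 1%R[)
      (beta_weight a b x /
        \int[lebesgue_measure]_(y in `]0%R, 1%R[) beta_weight a b y)%:E)%E.

Definition stick_breaking (W : nat -> {RV P >-> R}) (i : nat) (w : T) : R :=
  (\prod_(j < i) (1 - W j w)) * W i w.

Definition sigma_generated (V : nat -> T -> R) : set (set T) :=
  <<s [set B | exists i (A : set R), measurable A /\ B = V i @^-1` A] >>.

(* Given V, the labels L 0, L 1, ... are independent with P (L k = i) = V i;
   the conditional probability is characterised by integration over the events
   of the sigma-algebra generated by V. *)
Definition sampled_from (V : nat -> T -> R) (L : nat -> {RV P >-> nat}) : Prop :=
  forall (n : nat) (i : nat -> nat) (B : set T), sigma_generated V B ->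
    P (B `&` [set w | forall k, (k < n)%N -> L k w = i k]) =
    (\int[P]_(w in B) (\prod_(k < n) V (i k) w)%:E)%E.

End Probability.

Definition self_similar_markov (C : forall n, composition n -> R) : Prop :=
  composition_structure C /\
  exists (d : measure_display) (T : measurableType d) (P : probability T R)
    (Q : nat -> {RV P >-> nat}) (p : nat -> nat -> R),
    increasing_markov_chain Q p /\
    forall n, (1 <= n)%N -> forall l : composition n,
      (C n l)%:E =
      P [set w | binary_form l = [seq visits Q w j | j <- iota 1 n]].

Definition block_sizes (s : seq nat) : seq nat :=
  [seq count_mem i s | i <- undup s].

(* The variables W_1, W_2, ... and the labels are indexed from 0 here: W i is
   W_(i+1), which has the beta(1 - alpha, theta + (i+1) alpha) law. *)
Definition alpha_theta_partition_structure (alpha theta : R)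
    (pi : nat -> seq nat -> R) : Prop :=
  exists (d : measure_display) (T : measurableType d) (P : probability T R)
    (W : nat -> {RV P >-> R}) (L : nat -> {RV P >-> nat}),
    [/\ mutually_independent W,
        forall i, has_beta_law (1 - alpha) (theta + i.+1%:R * alpha) (W i),
        sampled_from (stick_breaking W) L &
        forall n, (1 <= n)%N -> forall lam : seq nat,
          (pi n lam)%:E =
          P [set w | ranked (block_sizes [seq L k w | k <- iota 0 n]) = lam]].

End Structures.

(* Main.v *)
Require Import Defs.
From mathcomp Require Import all_boot all_order all_algebra.
From mathcomp Require Import ring lra zify.
From mathcomp Require Import finmap.
From mathcomp Require Import all_classical all_reals all_analysis.
From mathcomp Require Import measurable_realfun.

(** Let [h n = (n - 1)! / (1 + theta)_(n-1)] and [w x = (1 - alpha)_(x-1) / x!].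
    The arrangement sought is
      [C_n(l_1, .., l_k) = h n * l_k * w l_k *
         prod_(j < k) w l_j * (alpha + theta * l_j / (l_1 + .. + l_j))]:
    the last box is a size-biased pick, and the boxes before it form, from right
    to left, a regenerative [(alpha, theta + alpha)] composition.  It is a Markov
    chain with [P_i (jump >= m) = h (i + m - 1) / h i * m * w m].

    Uniqueness: by deletion consistency at the compositions [n] and [k, n - k],
    the tails [P_i (jump >= m)] are determined, by induction on [i + m] and then
    on [i], by those with [i = 1], that is, by the probabilities of the one-block
    partitions.

    Law of the ranked composition: summing over the position of the last box
    gives a closed formula for the probability [D] that it has given parts.
    Discarding the first stick relates the probability that the samples with
    labels below [N] have a given shape to the same quantity for
    [theta + alpha] and [N - 1]; [D] satisfies the relation without the
    truncation, hence dominates the shape probability for every [N].  In the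
    limit [pi <= D], and both have total mass 1, so that they agree. *)

(** The tail [h (i + m - 1) / h i * m * w m] is shaped so that its differences in [m] factor into
    box weights. At [i = 1] it equals [(1 - alpha)_(n-1) / (1 + theta)_(n-1)], the one-block
    probability. Two elementary sums over the [k] parts [x] of a partition of [n] carry the ranked
    law: the terms [alpha + theta * x / n] add up to [theta + k * alpha] (choice of the last box),
    and the terms [x - alpha] add up to [n - k * alpha] (first stick; the event that it receives no
    ball supplies the missing [theta + k * alpha]).

    The obstacle is the infinite supply of labels. Equality would call for a proof that the sticks
    exhaust the unit mass. Domination does not: the recursion has non-negative coefficients, and
    with no label available the shape probability vanishes for a non-empty sample, so a finite
    induction on [N] is enough. The total mass of [pi] is 1 simply because every sampled label is a
    natural number.

    When [theta] is negative, the factors [alpha + theta * x / n] are positive only because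
    [x <= n]; this positivity serves both the existence and the uniqueness of the chain. *)

Set Implicit Arguments.
Unset Strict Implicit.
Unset Printing Implicit Defensive.

Import Order.TTheory GRing.Theory Num.Theory.
Import numFieldNormedType.Exports.

Local Open Scope classical_set_scope.
Local Open Scope ring_scope.

(** * Deleting a ball *)

(* The compositions with one more ball that yield [mu] when a ball is deleted,
   each listed once for every ball whose deletion yields [mu]. *)
Fixpoint grow (mu : seq nat) : seq (seq nat) :=
  if mu is y :: mu' then
    (1%N :: mu) :: nseq y.+1 (y.+1 :: mu') ++ [seq y :: l | l <- grow mu']
  else [:: [:: 1%N]].

(** The explicit weights factor at the last box, so sums over [grow] are computed by induction from
    the right end; this is the matching decomposition. A singleton inserted just before the box [x]
    is counted in [grow mu]. *)
Lemma grow_rcons mu x : perm_eq (grow (rcons mu x))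
  ([seq rcons l x | l <- grow mu] ++ nseq x.+1 (rcons mu x.+1)
    ++ [:: rcons (rcons mu x) 1%N]).
Proof.
elim: mu => [|y mu IH] //=.
rewrite perm_cons map_cat -map_comp map_nseq /= perm_cons.
rewrite -catA perm_cat2l; apply: perm_trans (perm_map _ IH) _.
by rewrite /= map_cat map_cons map_cat map_nseq -map_comp.
Qed.

Lemma grow_is_composition n mu : is_composition n mu ->
  all (is_composition n.+1) (grow mu).
Proof.
elim: mu n => [|y mu IH] n; rewrite /is_composition /=.
  by move=> /eqP <-.
move=> /andP[/andP[y0 mu0] /eqP <-].
rewrite y0 mu0 add1n eqxx all_cat all_nseq /= mu0 addSn eqxx orbT /=.
have : is_composition (sumn mu) mu by rewrite /is_composition mu0 /=.
move=> /IH /allP h; apply/allP => l /mapP[l' /h].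
by rewrite /is_composition => /andP[l0 /eqP l's] -> /=; rewrite y0 l0 l's addnS /=.
Qed.

(** A double count, by induction on the boxes of [l]. Balls of the first box correspond to the entry
    [1 :: mu] (the box disappears) or to the [y.+1] copies of the enlarged first box; balls further
    right correspond to the mapped tail of [grow]. *)
Lemma count_delete_ball l mu : all (leq 1) l -> all (leq 1) mu ->
  (\sum_(j < sumn l) (delete_ball l j == mu) = count_mem l (grow mu))%N.
Proof.
elim: l mu => [|k l IH] mu /= l0 mu0.
  rewrite big_ord0; symmetry; apply/count_memPn/negP.
  case: mu {mu0} => [|y mu] //=; rewrite !inE mem_cat mem_nseq /= andbF.
  by move/mapP => [].
move: l0 => /andP[k0 l0].
rewrite big_split_ord /=.
have -> : (\sum_(i < k) ((if (i < k)%N then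
      if k == 1%N then l else k.-1 :: l else k :: delete_ball l (i - k)) == mu) =
    k * ((if k == 1%N then l else k.-1 :: l) == mu))%N.
  rewrite (eq_bigr (fun=> ((if k == 1%N then l else k.-1 :: l) == mu) : nat)).
    by rewrite sum_nat_const card_ord.
  by move=> i _; rewrite ltn_ord.
have -> : (\sum_(i < sumn l) ((if (k + i < k)%N then
      if k == 1%N then l else k.-1 :: l else k :: delete_ball l (k + i - k)) == mu) =
    \sum_(i < sumn l) (k :: delete_ball l i == mu))%N.
  by apply: eq_bigr => i _; rewrite ltnNge leq_addr /= addKn.
case: mu mu0 => [_|y mu /= /andP[y0 mu0]].
  rewrite [X in (_ + X)%N]big1 //= addn0 addn0 eq_sym eqseq_cons.
  case: (k =P 1%N) => [->|k1]; rewrite ?mul1n.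
    by rewrite eqxx /= eq_sym.
  by rewrite muln0 eq_sym (introF eqP k1).
rewrite (eq_bigr (fun i : 'I_(sumn l) => (k == y) * (delete_ball l i == mu))%N); last first.
  by move=> i _; rewrite eqseq_cons mulnb.
rewrite -big_distrr /= IH // count_cat count_map count_nseq /=.
have -> : (count (preim (cons y) (pred1 (k :: l))) (grow mu) =
    (k == y) * count_mem l (grow mu))%N.
  case: (k =P y) => [->|ky].
    rewrite mul1n; apply: eq_count => z /=; by rewrite eqseq_cons eqxx.
  rewrite mul0n -[RHS](count_pred0 (grow mu)); apply: eq_count => z /=.
  by rewrite eqseq_cons eq_sym (introF eqP ky).
rewrite !addnA; congr (_ + _)%N; rewrite !eqseq_cons -addnA -mulnS.
case: (k =P 1%N) => [->|k1].
  rewrite mul1n /= eq_sym (_ : (y.+1 == 1)%N = false) ?mul0n ?addn0 //.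
  by case: (y) y0.
rewrite (_ : (1 == k)%N = false) ?add0n; last by rewrite eq_sym; apply/eqP.
rewrite eqseq_cons -(eq_sym l) -(eq_sym k).
rewrite (_ : (k == y.+1) = (k.-1 == y)); last by case: (k) k0.
case: (k.-1 =P y) => /=; rewrite ?muln0 ?mul0n //.
by move=> <-; rewrite prednK // mulnC.
Qed.

Lemma delete_ball_is_composition n l j : is_composition n l -> (j < n)%N ->
  is_composition n.-1 (delete_ball l j).
Proof.
rewrite /is_composition => /andP[l0 /eqP <-] {n}.
elim: l j l0 => //= k l IH j /andP[k0 l0] jlt.
case: ifP => jk.
  case: ifP => [/eqP -> | /negbT k1] /=; first by rewrite l0 /=; apply/eqP; lia.
  by rewrite l0; case: k k0 k1 {jk jlt} => // -[|k] //= _ _; apply/eqP; lia.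
have jk' : (j - k < sumn l)%N by lia.
have /andP[h1 /eqP h2] := IH _ l0 jk'.
rewrite /= k0 h1 h2 /=; apply/eqP; lia.
Qed.

Section DeletionSum.
Variable R : realFieldType.

Lemma sum_count_composition n (f : seq nat -> R) (G : seq (seq nat)) :
  all (is_composition n) G ->
  \sum_(l : composition n) f l * (count_mem (l : seq nat) G)%:R = \sum_(l <- G) f l.
Proof.
elim: G => [|g G IH] /=; first by rewrite big_nil big1 // => l _; rewrite mulr0.
move=> /andP[gn Gn]; rewrite big_cons -IH //.
under eq_bigr => l _ do rewrite natrD mulrDr.
rewrite big_split /=; congr (_ + _).
rewrite (bigD1 (Composition gn)) //= eqxx mulr1 big1 ?addr0 // => l lg.
rewrite (_ : (g == l :> seq nat) = false) ?mulr0 //.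
by apply: contra_neqF lg => /eqP gl; apply: val_inj.
Qed.

(** Turns deletion consistency into an identity for sums over [grow], the only form in which it is
    used afterwards. *)
Lemma deletion_sum n (f : seq nat -> R) (mu : composition n.-1) : (1 <= n)%N ->
  \sum_(l : composition n)
    f l * (#|[set j : 'I_n | delete_ball l j == mu]%SET|%:R / n%:R) =
  (\sum_(l <- grow mu) f l) / n%:R.
Proof.
move=> n1; rewrite mulr_suml.
under eq_bigr => l _ do rewrite mulrA.
rewrite -!mulr_suml; congr (_ / _).
rewrite -(@sum_count_composition n); last first.
  by rewrite -{1}(prednK n1); apply: grow_is_composition; case: mu.
apply: eq_bigr => l _; congr (_ * _%:R).
case: l => l /=; rewrite /is_composition => /andP[l0 /eqP ln].
case: mu => mu /= /andP[mu0 _].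
rewrite -count_delete_ball // ln -sum1_card big_mkcond /=.
by apply: eq_bigr => j _; rewrite inE; case: ifP.
Qed.

End DeletionSum.

(** * The explicit weights *)

Section ChainWeight.
Variables (R : realFieldType) (p : nat -> nat -> R).

(* The chain started from [i] fills the boxes [l]; the last box is only known to
   have at least [last 0 l] balls. *)
Fixpoint chain_weight (i : nat) (l : seq nat) : R :=
  if l is m :: l' then
    if nilp l' then 1 - \sum_(i.+1 <= j < i + m) p i j
    else p i (i + m)%N * chain_weight (i + m)%N l'
  else 1.

End ChainWeight.

Section Weights.
Variables (R : realFieldType) (alpha theta : R).
Hypotheses (alpha_ge0 : 0 <= alpha) (alpha_lt1 : alpha < 1)
  (theta_gt : - alpha < theta).

Definition rising (b : R) (n : nat) : R := \prod_(i < n) (b + i%:R).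

Lemma risingS b n : rising b n.+1 = rising b n * (b + n%:R).
Proof. by rewrite /rising big_ord_recr. Qed.

Lemma rising_recl b n : rising b n.+1 = b * rising (b + 1) n.
Proof.
rewrite /rising big_ord_recl addr0; congr (_ * _); apply: eq_bigr => i _.
by rewrite /= /bump /= natrD addrA.
Qed.

Lemma rising_gt0 b n : 0 < b -> 0 < rising b n.
Proof. by move=> b0; apply: prodr_gt0 => i _; rewrite ltr_wpDr. Qed.

Definition box_weight (x : nat) : R := rising (1 - alpha) x.-1 / x`!%:R.

Lemma box_weight_gt0 x : 0 < box_weight x.
Proof. by rewrite divr_gt0 ?rising_gt0 ?subr_gt0// ltr0n fact_gt0. Qed.

Lemma box_weight1 : box_weight 1 = 1.
Proof. by rewrite /box_weight /rising big_ord0 divr1. Qed.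

Lemma box_weightS x : (0 < x)%N ->
  box_weight x.+1 = (x%:R - alpha) * box_weight x / x.+1%:R.
Proof.
case: x => // x _; rewrite /box_weight /= risingS (factS x.+1) natrM.
have f0 : x.+1`!%:R != 0 :> R by rewrite pnatr_eq0 -lt0n fact_gt0.
have x0 : 0 <= x%:R :> R by [].
have -> : x.+2%:R = x%:R + 2 :> R by rewrite -addn2 natrD.
have -> : x.+1%:R = 1 + x%:R :> R by rewrite -natr1 addrC.
by field; rewrite f0 lt0r_neq0 //; lra.
Qed.

(* With [s = 0] and parameter [theta + alpha], the weights of a regenerative
   composition read from right to left. *)
Fixpoint arrangement_weight (s : nat) (l : seq nat) : R :=
  if l is x :: l' then
    box_weight x * (alpha + theta * x%:R / (s + x)%:R)
      * arrangement_weight (s + x) l'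
  else 1.

Lemma arrangement_weight_rcons s l x :
  arrangement_weight s (rcons l x) = arrangement_weight s l *
    (box_weight x * (alpha + theta * x%:R / (s + sumn l + x)%:R)).
Proof.
elim: l s => [|y l IH] s /=; first by rewrite addn0 mulr1 mul1r.
by rewrite IH addnA !mulrA.
Qed.

Lemma sum_nseq (I : Type) (f : I -> R) n x :
  \sum_(l <- nseq n x) f l = n%:R * f x.
Proof. by rewrite big_nseq iter_addr addr0 mulr_natl. Qed.

Lemma sum_grow_rcons (f : seq nat -> R) mu x :
  \sum_(l <- grow (rcons mu x)) f l =
  \sum_(l <- grow mu) f (rcons l x) + x.+1%:R * f (rcons mu x.+1)
    + f (rcons (rcons mu x) 1%N).
Proof.
rewrite (perm_big _ (grow_rcons mu x)) big_cat big_map big_cat sum_nseq.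
by rewrite big_seq1 /= addrA.
Qed.

Lemma sumn_grow mu l : l \in grow mu -> sumn l = (sumn mu).+1.
Proof.
elim: mu l => [|y mu IH] l /=; first by rewrite inE => /eqP ->.
rewrite !inE mem_cat mem_nseq => /or3P[/eqP -> //|/eqP -> //|/orP[/andP[_ /eqP ->] //|]].
by move=> /mapP[l' /IH h ->] /=; rewrite h addnS.
Qed.

(** The consistency of the regenerative part: [theta + alpha + n] is the ratio of the consecutive
    rising factorials [(theta + alpha)_n] that normalise these weights. *)
Lemma sum_grow_arrangement_weight mu : all (leq 1) mu ->
  \sum_(l <- grow mu) arrangement_weight 0 l =
  (theta + alpha + (sumn mu)%:R) * arrangement_weight 0 mu.
Proof.
elim/last_ind: mu => [_|mu x IH].
  rewrite big_seq1 /= add0n box_weight1 divr1; ring.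
rewrite all_rcons => /andP[x0 /IH {}IH].
rewrite sum_grow_rcons.
under eq_big_seq => l lmu do rewrite arrangement_weight_rcons (sumn_grow lmu).
rewrite -mulr_suml IH !arrangement_weight_rcons sumn_rcons !add0n box_weight1.
rewrite box_weightS //.
set A := arrangement_weight 0 mu; set w := box_weight x.
set m := sumn mu.
have -> : (m + x.+1)%:R = m%:R + x%:R + 1 :> R by rewrite addnS -natr1 natrD.
have -> : (m + x + 1)%:R = m%:R + x%:R + 1 :> R by rewrite !natrD.
have -> : (m.+1 + x)%:R = m%:R + x%:R + 1 :> R by rewrite addSn -natr1 natrD.
rewrite natrD.
have -> : x.+1%:R = x%:R + 1 :> R by rewrite -natr1.
have x0' : 0 < x%:R :> R by rewrite ltr0n.
have m0 : 0 <= m%:R :> R by [].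
field.
apply/and3P; split; apply: lt0r_neq0; lra.
Qed.

(* [n! / (theta + 1)_n] with the index shifted so that a state of the chain can
   be used as argument. *)
Definition scale_fun (n : nat) : R := (n.-1)`!%:R / rising (1 + theta) n.-1.

Lemma scale_fun_gt0 n : 0 < scale_fun n.
Proof.
rewrite divr_gt0 ?rising_gt0 ?ltr0n ?fact_gt0 //; move: alpha_lt1 theta_gt; lra.
Qed.

Lemma scale_fun1 : scale_fun 1 = 1.
Proof. by rewrite /scale_fun /rising big_ord0 divr1. Qed.

Lemma scale_funS n : (0 < n)%N ->
  scale_fun n.+1 = scale_fun n * (n%:R / (theta + n%:R)).
Proof.
move: (alpha_ge0) (alpha_lt1) (theta_gt) => a0 a1 t0.
case: n => // n _; rewrite /scale_fun /= factS natrM risingS.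
have r0 : rising (1 + theta) n != 0.
  by apply: lt0r_neq0; apply: rising_gt0; lra.
have n0 : 0 <= n%:R :> R by [].
have -> : n.+1%:R = n%:R + 1 :> R by rewrite -natr1.
by field; rewrite r0 andbT /= lt0r_neq0 //; lra.
Qed.

Definition tail_prob (i m : nat) : R :=
  scale_fun (i + m).-1 / scale_fun i * (m%:R * box_weight m).

Definition trans_prob (i j : nat) : R :=
  if (i < j)%N then tail_prob i (j - i) - tail_prob i (j - i).+1 else 0.

Lemma tail_prob1 i : tail_prob i 1 = 1.
Proof.
rewrite /tail_prob addn1 /= divff ?mul1r ?box_weight1 //.
exact/lt0r_neq0/scale_fun_gt0.
Qed.

Lemma tail_prob_gt0 i m : (0 < m)%N -> 0 < tail_prob i m.
Proof.
move=> m0; apply: mulr_gt0; first by apply: divr_gt0; exact: scale_fun_gt0.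
by apply: mulr_gt0; [rewrite ltr0n | exact: box_weight_gt0].
Qed.

(** The ratio of consecutive [scale_fun] leaves [m + theta * m / (i + m - 1) - (m - alpha)], in
    which [m] cancels. In state [i] there are [i - 1] balls in the boxes already filled, so
    [(i + m).-1] counts the balls up to the end of the new box. *)
Lemma trans_probE i m : (0 < i)%N -> (0 < m)%N ->
  trans_prob i (i + m)%N = scale_fun (i + m) / scale_fun i *
    (box_weight m * (alpha + theta * m%:R / (i + m).-1%:R)).
Proof.
move: (alpha_ge0) (alpha_lt1) (theta_gt) => a0 a1 t0.
move=> i0 m0; rewrite /trans_prob -{1}(addn0 i) ltn_add2l m0 addKn /tail_prob.
have [n nE] : exists n, (i + m)%N = n.+2 by exists (i + m).-2; lia.
rewrite addnS nE /= (@scale_funS n.+1) // box_weightS //.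
have h0 : scale_fun i != 0 by exact/lt0r_neq0/scale_fun_gt0.
have mr : 1 <= m%:R :> R by rewrite ler1n.
have nr : 0 <= n%:R :> R by [].
have -> : m.+1%:R = m%:R + 1 :> R by rewrite -natr1.
have -> : n.+1%:R = n%:R + 1 :> R by rewrite -natr1.
field.
rewrite h0 /=; do !(apply/andP; split); apply: lt0r_neq0; lra.
Qed.

Lemma trans_prob_gt0 i j : (0 < i)%N -> (i < j)%N -> 0 < trans_prob i j.
Proof.
move: (alpha_ge0) (alpha_lt1) (theta_gt) => a0 a1 t0.
move=> i0 ij; rewrite -(subnKC (ltnW ij)) trans_probE ?subn_gt0 //.
have m0 : (0 < j - i)%N by rewrite subn_gt0.
move: (j - i)%N m0 => m m0.
apply: mulr_gt0; first by apply: divr_gt0; exact: scale_fun_gt0.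
apply: mulr_gt0; first exact: box_weight_gt0.
have nr : 0 < (i + m).-1%:R :> R by rewrite ltr0n; lia.
have mr : m%:R <= (i + m).-1%:R :> R by rewrite ler_nat; lia.
have mr0 : 0 < m%:R :> R by rewrite ltr0n.
(* [theta] may be negative. Multiplied by the ball count [n = (i + m).-1], the factor becomes
   [alpha * (n - m) + (theta + alpha) * m], a sum of a non-negative and a positive term. *)
rewrite -(pmulr_lgt0 _ nr) mulrDl divfK ?lt0r_neq0 //.
have : 0 <= alpha * ((i + m).-1%:R - m%:R) by rewrite mulr_ge0 // subr_ge0.
have : 0 < (theta + alpha) * m%:R by rewrite mulr_gt0 //; lra.
lra.
Qed.

Lemma trans_prob_ge0 i j : (0 < i)%N -> 0 <= trans_prob i j.
Proof.
move=> i0; have [ij|ij] := ltnP i j; first exact/ltW/trans_prob_gt0.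
by rewrite /trans_prob ltnNge ij.
Qed.

Lemma sum_trans_prob i m : (0 < m)%N ->
  \sum_(i.+1 <= j < i + m) trans_prob i j = 1 - tail_prob i m.
Proof.
case: m => // m _; elim: m => [|m IH].
  by rewrite addn1 big_geq // tail_prob1 subrr.
rewrite addnS big_nat_recr /=; last by lia.
rewrite IH /trans_prob addnS ltnS leq_addr -addnS addKn; ring.
Qed.

(** The ratios of [scale_fun] telescope along the jumps, leaving the weights of a regenerative
    composition; the last box enters through a tail, whence its size-biasing factor [x]. State
    [s.+1] means that [s] balls precede. *)
Lemma chain_weight_rcons s mu x : all (leq 1) mu -> (0 < x)%N ->
  chain_weight trans_prob s.+1 (rcons mu x) =
  scale_fun (s + sumn mu + x) / scale_fun s.+1
    * arrangement_weight s mu * (x%:R * box_weight x).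
Proof.
elim: mu s => [|y mu IH] s /=.
  by move=> _ x0; rewrite sum_trans_prob // opprB addrC subrK addn0 mulr1.
move=> /andP[y0 mu0] x0.
rewrite (_ : nilp (rcons mu x) = false); last by case: (mu).
rewrite addSn (IH (s + y)%N) // -addSn trans_probE // addSn /= addnA.
have h0 : scale_fun s.+1 != 0 by exact/lt0r_neq0/scale_fun_gt0.
have h1 : scale_fun (s + y).+1 != 0 by exact/lt0r_neq0/scale_fun_gt0.
have sy0 : s%:R + y%:R != 0 :> R by rewrite -natrD pnatr_eq0; lia.
by field; rewrite h0 h1 sy0.
Qed.

Lemma chain_weight_gt0 s l : all (leq 1) l -> 0 < chain_weight trans_prob s.+1 l.
Proof.
elim: l s => //= m l IH s /andP[m0 l0]; case: ifP => _.
  by rewrite sum_trans_prob // opprB addrC subrK tail_prob_gt0.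
by rewrite addSn mulr_gt0 ?IH // trans_prob_gt0 //; lia.
Qed.

(** With [n] balls, [x] of them in the last box, the three kinds of growth contribute, up to a
    common factor, [x * (theta + alpha + n - x)] for the earlier boxes, [(x + 1) * (x - alpha)] for
    the last box and [alpha + theta * x / n] for a new last box. The total is
    [x * (n + 1) * (theta + n) / n], and [scale_fun] absorbs [(theta + n) / n]. *)
Lemma sum_grow_chain_weight mu : all (leq 1) mu -> mu != [::] ->
  \sum_(l <- grow mu) chain_weight trans_prob 1 l =
  (sumn mu).+1%:R * chain_weight trans_prob 1 mu.
Proof.
move: (alpha_ge0) (alpha_lt1) (theta_gt) => a0 a1 t0.
elim/last_ind: mu => // mu x _; rewrite all_rcons => /andP[x0 mu0] _.
rewrite sum_grow_rcons.
have growP l : l \in grow mu -> all (leq 1) l.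
  move=> lmu; have : is_composition (sumn mu) mu by rewrite /is_composition mu0 /=.
  by move=> /grow_is_composition/allP/(_ _ lmu) /andP[].
rewrite (eq_big_seq (fun l => scale_fun (sumn mu + x.+1)
    * arrangement_weight 0 l * (x%:R * box_weight x))); last first.
  move=> l lmu; rewrite (chain_weight_rcons 0) ?growP // scale_fun1 divr1.
  by rewrite (sumn_grow lmu) add0n addnS.
rewrite -mulr_suml -mulr_sumr sum_grow_arrangement_weight //.
rewrite !(chain_weight_rcons 0) // ?all_rcons ?x0 // scale_fun1 !divr1.
rewrite arrangement_weight_rcons !sumn_rcons !add0n addnS addn1 !box_weight1.
rewrite scale_funS; last by lia.
rewrite box_weightS //.
set A := arrangement_weight 0 mu; set w := box_weight x.
set m := sumn mu; set h := scale_fun _.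
have -> : (m + x).+1%:R = m%:R + x%:R + 1 :> R by rewrite -natr1 natrD.
rewrite !natrD.
have -> : x.+1%:R = x%:R + 1 :> R by rewrite -natr1.
have x0' : 1 <= x%:R :> R by rewrite ler1n.
have m0 : 0 <= m%:R :> R by [].
field.
do !(apply/andP; split); apply: lt0r_neq0; lra.
Qed.

Definition ss_markov_pmf (n : nat) (l : composition n) : R :=
  chain_weight trans_prob 1 l.

Lemma ss_markov_deletion n (mu : composition n.-1) : (2 <= n)%N ->
  ss_markov_pmf mu = \sum_(l : composition n) ss_markov_pmf l *
    (#|[set j : 'I_n | delete_ball l j == mu]%SET|%:R / n%:R).
Proof.
move=> n2; rewrite (deletion_sum (chain_weight trans_prob 1)); last by lia.
have /andP[mu0 /eqP mun] := partsP mu.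
rewrite sum_grow_chain_weight //; last first.
  by apply/eqP => h; move: mun; rewrite h /=; lia.
rewrite mun prednK; last by lia.
by rewrite mulrAC divff ?mul1r // pnatr_eq0; lia.
Qed.

(** Deletion carries total mass from one level to the next, since each ball of [l] leads to exactly
    one [mu]; hence all levels have the mass of level 1. *)
Lemma ss_markov_pmf_sum n : (1 <= n)%N -> \sum_(l : composition n) ss_markov_pmf l = 1.
Proof.
case: n => // n _; elim: n => [|n IH].
  have one1 : is_composition 1 [:: 1%N] by [].
  rewrite (bigD1 (Composition one1)) //= big1 ?addr0.
    by rewrite /ss_markov_pmf /= big_geq // subr0.
  move=> l; suff -> : l = Composition one1 by rewrite eqxx.
  apply: val_inj; case: l => l /= /andP[l0 /eqP]; case: l l0 => //= x l.
  move=> /andP[x0 l0] xl; have -> : x = 1%N by lia.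
  by case: l l0 xl => //= y l /andP[y0 _]; lia.
rewrite -IH (eq_bigr _ (fun mu _ => @ss_markov_deletion n.+2 mu isT)) exchange_big /=.
apply: eq_bigr => l _; rewrite -mulr_sumr -mulr_suml -natr_sum.
suff -> : (\sum_(mu : composition n.+1)
    #|[set j : 'I_n.+2 | delete_ball l j == mu]%SET|)%N = n.+2.
  by rewrite divff ?mulr1 // pnatr_eq0.
transitivity (\sum_(j : 'I_n.+2) 1)%N; last by rewrite sum_nat_const card_ord muln1.
under eq_bigr => mu _ do rewrite -sum1_card big_mkcond /=.
rewrite exchange_big /=; apply: eq_bigr => j _.
have lj := delete_ball_is_composition (partsP l) (ltn_ord j).
rewrite (bigD1 (Composition lj)) //= inE eqxx big1 // => mu muE.
rewrite inE; case: eqP => // h.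
by case/eqP: muE; apply: val_inj.
Qed.

End Weights.

Lemma ss_markov_composition_structure (R : realType) (alpha theta : R) :
  0 <= alpha -> alpha < 1 -> - alpha < theta ->
  composition_structure (ss_markov_pmf alpha theta).
Proof.
move=> a0 a1 t0; split=> [n n1|n n2 mu]; last exact: ss_markov_deletion.
split; last exact: ss_markov_pmf_sum.
by move=> l; apply/ltW/chain_weight_gt0 => //; have /andP[] := partsP l.
Qed.

(** * A chain whose compositions are consistent is determined by its first step *)

Arguments chain_weight : simpl never.

Section ChainWeightUnique.
Variables (R : realFieldType) (p q : nat -> nat -> R).

Lemma chain_weight_seq1 i m :
  chain_weight p i [:: m] = 1 - \sum_(i.+1 <= j < i + m) p i j.
Proof. by []. Qed.

Lemma chain_weight_unit i : chain_weight p i [:: 1%N] = 1.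
Proof. by rewrite chain_weight_seq1 addn1 big_geq // subr0. Qed.

Lemma transition_chain_weight i m : (0 < m)%N ->
  p i (i + m)%N = chain_weight p i [:: m] - chain_weight p i [:: m.+1].
Proof.
move=> m0; rewrite !chain_weight_seq1 addnS big_nat_recr /=; last by lia.
ring.
Qed.

End ChainWeightUnique.

Definition deletion_consistent (R : realFieldType) (p : nat -> nat -> R) :=
  forall mu, all (leq 1) mu -> mu != [::] ->
  \sum_(l <- grow mu) chain_weight p 1 l = (sumn mu).+1%:R * chain_weight p 1 mu.

(** Each consistency equation used is linear in one unknown tail, whose coefficient is built from
    transition probabilities; positivity of [p] allows division by it. *)
Lemma chain_weight_unique (R : realFieldType) (p q : nat -> nat -> R) :
  (forall i j, (0 < i)%N -> (i < j)%N -> 0 < p i j) ->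
  deletion_consistent p -> deletion_consistent q ->
  (forall n, (0 < n)%N -> chain_weight p 1 [:: n] = chain_weight q 1 [:: n]) ->
  forall l, all (leq 1) l -> chain_weight p 1 l = chain_weight q 1 l.
Proof.
move=> p0 Dp Dq pq1.
pose P i m := chain_weight p i [:: m] = chain_weight q i [:: m].
have trans i m : (0 < m)%N -> P i m -> P i m.+1 -> p i (i + m)%N = q i (i + m)%N.
  by move=> m0 Pm PSm; rewrite !transition_chain_weight // Pm PSm.
have step (a : nat -> nat -> R) i x y l : chain_weight a i (x :: y :: l) =
  a i (i + x)%N * chain_weight a (i + x) (y :: l) by [].
(* Deleting a ball from the boxes [k; m] involves the box starting at [k + 2]
   only with [m] balls, and with a positive coefficient. *)
have main K i m : (0 < i)%N -> (0 < m)%N -> (i + m = K)%N -> P i m.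
  elim/ltn_ind: K i m => K IHK; elim/ltn_ind => i IHi m i0 m0 im.
  case: i i0 IHi im => // -[|k] _ IHi im; first exact: pq1.
  have p1 x : (0 < x)%N -> p 1%N (1 + x)%N = q 1%N (1 + x)%N.
    by move=> x0; apply: trans; rewrite // /P pq1.
  have p12 := p1 1%N isT.
  have [k0|k0] := posnP k.
    (* State 2 is reached only through a first box of one ball, so the equation at the single box
       [[:: m]] already isolates its tail. *)
    subst k; have m1 : all (leq 1) [:: m] by rewrite /= m0.
    have grow1 : grow [:: m] = [:: [:: 1%N; m]] ++ nseq m.+1 [:: m.+1] ++ [:: [:: m; 1%N]] by [].
    have := Dp _ m1 isT; have := Dq _ m1 isT.
    rewrite grow1 !big_cat !sum_nseq !big_seq1 !step. rewrite !chain_weight_unit.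
    rewrite -p12 -p1 // -!pq1 // => <- /= /addIr.
    by apply: mulfI; rewrite lt0r_neq0 // p0.
  have km1 : all (leq 1) [:: k; m] by rewrite /= k0 m0.
  have unitP i : P i 1%N by rewrite /P !chain_weight_unit.
  have P1 x y : (0 < x)%N -> (0 < y)%N -> (x + y < K)%N -> P x y.
    by move=> x0 y0 xyK; apply: (IHK _ xyK).
  have P2 x y : (0 < x)%N -> (0 < y)%N -> (x + y <= K)%N -> (x < k.+2)%N -> P x y.
    move=> x0 y0; rewrite leq_eqVlt => /orP[/eqP xyK xk|]; last by move=> *; exact: P1.
    exact: IHi.
  have grow2 : grow [:: k; m] = [:: [:: 1%N; k; m]] ++ nseq k.+1 [:: k.+1; m] ++
      [:: [:: k; 1%N; m]] ++ nseq m.+1 [:: k; m.+1] ++ [:: [:: k; m; 1%N]].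
    by rewrite /= map_cat map_nseq.
  have := Dp _ km1 isT; have := Dq _ km1 isT.
  rewrite grow2 !big_cat !sum_nseq !big_seq1 !step !chain_weight_unit.
  rewrite -p12 -p1 // -p1 // -(P1 (1 + k)%N m) //; last by lia.
  rewrite -(trans 2%N k) //; [| by apply: P1; lia | by apply: P2; lia].
  rewrite -(trans (1 + k)%N 1%N) //; last by apply: P2; lia.
  rewrite -(trans (1 + k)%N m) //; [| by apply: P1; lia | by apply: P2; lia].
  rewrite -(P2 (1 + k)%N m.+1) //; try lia.
  (* The box of [m] balls starts at [k + 2] after one of three paths: 1, 2, [k + 2], or 1, [k + 2]
     (with multiplicity [k + 1]), or 1, [k + 1], [k + 2]. Their probabilities add up to the
     coefficient of the unknown. *)
  have -> : (1 + k.+1 = k.+2)%N by [].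
  have -> : (2 + k = k.+2)%N by [].
  have -> : (1 + k + 1 = k.+2)%N by lia.
  set c1 := p 1%N (1 + 1)%N; set c2 := p 2%N k.+2; set c3 := p 1%N k.+2.
  set c4 := p 1%N (1 + k)%N; set c5 := p (1 + k)%N k.+2.
  have c1_gt0 : 0 < c1 by apply: p0.
  have c2_gt0 : 0 < c2 by apply: p0.
  have c3_gt0 : 0 < c3 by apply: p0.
  have c4_gt0 : 0 < c4 by apply: p0; lia.
  have c5_gt0 : 0 < c5 by apply: p0; lia.
  have kc3 : 0 < k.+1%:R * c3 by rewrite mulr_gt0.
  have c12 : 0 < c1 * c2 by rewrite mulr_gt0.
  have c45 : 0 < c4 * c5 by rewrite mulr_gt0.
  move=> <- /= e; have c_neq0 : c1 * c2 + k.+1%:R * c3 + c4 * c5 != 0.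
    by rewrite lt0r_neq0 // !addr_gt0.
  apply: (mulfI c_neq0); apply/eqP; rewrite -subr_eq0; apply/eqP.
  by move/eqP: e; rewrite -subr_eq0 => /eqP <-; ring.
move=> l; suff gen i : (0 < i)%N -> all (leq 1) l ->
    chain_weight p i l = chain_weight q i l by exact: gen.
elim: l i => // m [|y l] IH i i0 /andP[m0 l0]; first exact: main.
rewrite !step IH //; last by lia.
by congr (_ * _); apply: trans => //; exact: main.
Qed.

(** * The law of the ranked composition *)

(** The recursions on weights single out the last box, whereas [permutationsE] splits off the first
    entry; reversal passes from one to the other. *)
Lemma sum_permutations_rcons (V : nmodType) (T : eqType) (f : seq T -> V) (s : seq T) :
  s != [::] ->
  \sum_(t <- permutations s) f t =
  \sum_(x <- undup s) \sum_(t <- permutations (rem x s)) f (rcons t x).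
Proof.
move=> s0.
have permsV (u : seq T) : perm_eq (permutations u) [seq rev t | t <- permutations u].
  apply: uniq_perm; rewrite ?permutations_uniq //.
    by rewrite map_inj_uniq ?permutations_uniq //; exact: can_inj revK.
  move=> t; rewrite mem_permutations; apply/idP/mapP => [tu|[t' + ->]].
    by exists (rev t); rewrite ?revK // mem_permutations perm_rev.
  by rewrite mem_permutations perm_rev.
rewrite (perm_big _ (permsV s)) big_map.
rewrite (perm_big _ (permutationsE _)) /=; last by rewrite lt0n size_eq0.
rewrite big_allpairs_dep /=; apply: eq_bigr => x _.
rewrite [RHS](perm_big _ (permsV (rem x s))) big_map.
by apply: eq_bigr => t _; rewrite rev_cons.
Qed.

Lemma sum_undup_count (R : pzSemiRingType) (T : eqType) (s : seq T) (f : T -> R) :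
  \sum_(x <- undup s) (count_mem x s)%:R * f x = \sum_(x <- s) f x.
Proof.
rewrite -[RHS]big_undup_iterop_count; apply: eq_bigr => x _.
by rewrite mulr_natl.
Qed.

Lemma sumn_rem x s : x \in s -> (x + sumn (rem x s))%N = sumn s.
Proof. by move=> xs; rewrite (perm_sumn (perm_to_rem xs)). Qed.

Lemma sum_const_seq (V : nmodType) (T : Type) (s : seq T) (x : V) :
  \sum_(i <- s) x = x *+ size s.
Proof. by rewrite big_const_seq count_predT iter_addr_0. Qed.

Section PartitionWeight.
Variable R : realFieldType.

Definition symmetry_factor (s : seq nat) : R :=
  \prod_(x <- undup s) ((count_mem x s)`!%:R)^-1.

Lemma symmetry_factor_ge0 s : 0 <= symmetry_factor s.
Proof. by apply: prodr_ge0 => x _; rewrite invr_ge0. Qed.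

(** The multiplicity gained here is what turns a sum over distinct parts into a sum over all parts,
    through [sum_undup_count]. *)
Lemma symmetry_factor_rem x s : x \in s ->
  symmetry_factor (rem x s) = (count_mem x s)%:R * symmetry_factor s.
Proof.
move=> xs; rewrite /symmetry_factor.
(* A part occurring once is lost from [undup (rem x s)]; putting it back costs the factor
   [1 / 0! = 1], so both products can range over [undup s]. *)
have -> : \prod_(y <- undup (rem x s)) ((count_mem y (rem x s))`!%:R)^-1 =
    \prod_(y <- undup s) ((count_mem y (rem x s))`!%:R)^-1 :> R.
  rewrite [RHS](bigID (mem (rem x s))) /= [X in _ = _ * X]big1 ?mulr1; last first.
    by move=> y; rewrite -has_pred1 has_count -leqNgt leqn0 => /eqP ->; rewrite invr1.
  rewrite -[RHS]big_filter; apply: perm_big; apply: uniq_perm; rewrite ?filter_uniq ?undup_uniq //.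
  by move=> y; rewrite mem_filter !mem_undup /= andb_idr // => /mem_rem.
have xu : x \in undup s by rewrite mem_undup.
rewrite !(big_rem x xu) /= mulrA; congr (_ * _).
  rewrite count_rem xs /= eqxx.
  have : (0 < count_mem x s)%N by rewrite -has_count has_pred1.
  case: (count_mem x s) => // c _; rewrite subn1 /= factS natrM invfM mulVKf //.
rewrite (rem_filter _ (undup_uniq s)) !big_filter; apply: eq_bigr => y /= yx.
by rewrite count_rem xs /= eq_sym (negbTE yx) subn0.
Qed.

Variables (alpha : R).
Hypotheses (alpha_ge0 : 0 <= alpha) (alpha_lt1 : alpha < 1).

Definition new_block_prod (theta : R) (k : nat) : R :=
  \prod_(j < k) (theta + j.+1%:R * alpha).

(* The probability that the blocks of an [(alpha, theta)] random partition have
   the sizes [s], in any order. *)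
Definition partition_weight (theta : R) (s : seq nat) : R :=
  symmetry_factor s * (sumn s)`!%:R * (\prod_(x <- s) box_weight alpha x)
  * new_block_prod theta (size s).-1 / rising (1 + theta) (sumn s).-1.

Lemma partition_weight_ge0 theta s : - alpha < theta -> 0 <= partition_weight theta s.
Proof.
move: alpha_ge0 alpha_lt1 => a0 a1 t0.
rewrite /partition_weight divr_ge0 ?(ltW (rising_gt0 _ _)) //; last lra.
rewrite !mulr_ge0 ?symmetry_factor_ge0 //.
  by apply: prodr_ge0 => x _; exact/ltW/box_weight_gt0.
apply: prodr_ge0 => j _; have : 0 <= j%:R * alpha by rewrite mulr_ge0.
rewrite -natr1 mulrDl; lra.
Qed.

(** Induction by removal of the last box: summed over all [k] parts [x], the factor
    [alpha + theta * x / n] gives [theta + k * alpha], the last factor of [new_block_prod]. *)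
Lemma sum_permutations_arrangement_weight theta s : all (leq 1) s ->
  \sum_(t <- permutations s) arrangement_weight alpha theta 0 t =
  symmetry_factor s * (\prod_(x <- s) box_weight alpha x)
    * new_block_prod theta (size s).
Proof.
have [n sn] : exists n, size s = n by exists (size s).
elim: n s sn => [|n IH] s sn s1.
  move/size0nil: sn => ->; rewrite /permutations /= big_seq1 /symmetry_factor.
  by rewrite /new_block_prod /= !big_nil big_ord0 !mulr1.
have s0 : s != [::] by rewrite -size_eq0 sn.
rewrite sum_permutations_rcons //.
pose c := symmetry_factor s * (\prod_(x <- s) box_weight alpha x) * new_block_prod theta n.
transitivity (\sum_(x <- undup s)
    (count_mem x s)%:R * ((alpha + theta * x%:R / (sumn s)%:R) * c)).
  apply: eq_big_seq => x; rewrite mem_undup => xs.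
  under eq_big_seq => t.
    rewrite mem_permutations => /perm_sumn ts.
    rewrite arrangement_weight_rcons ts add0n addnC sumn_rem //; over.
  rewrite -mulr_suml IH; [|by rewrite size_rem // sn|]; last first.
    by apply/allP => y /mem_rem; exact: (allP s1).
  rewrite symmetry_factor_rem // size_rem // sn /= /c (big_rem x xs) /=; ring.
rewrite sum_undup_count -mulr_suml big_split /= -!mulr_suml -mulr_sumr -natr_sum -sumnE.
have n0 : (sumn s)%:R != 0 :> R.
  rewrite pnatr_eq0; case: s s0 s1 {IH sn c} => //= x s _ /andP[]; lia.
rewrite mulfK // sum_const_seq sn.
by rewrite /c /new_block_prod big_ord_recr /= -mulr_natl; ring.
Qed.

(** The size-biased last box contributes the sum of all parts, that is [n], which completes the
    [(n - 1)!] of [scale_fun] to [n!]; the other [k - 1] boxes give [new_block_prod]. *)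
Lemma sum_permutations_chain_weight theta s : - alpha < theta ->
  all (leq 1) s -> s != [::] ->
  \sum_(t <- permutations s) chain_weight (trans_prob alpha theta) 1 t =
  partition_weight theta s.
Proof.
move=> t0 s1 s0; rewrite sum_permutations_rcons //.
pose c := scale_fun theta (sumn s) * symmetry_factor s
  * (\prod_(x <- s) box_weight alpha x) * new_block_prod theta (size s).-1.
transitivity (\sum_(x <- undup s) (count_mem x s)%:R * (x%:R * c)).
  apply: eq_big_seq => x; rewrite mem_undup => xs.
  have rem1 : all (leq 1) (rem x s).
    by apply/allP => y /mem_rem; exact: (allP s1).
  under eq_big_seq => t.
    rewrite mem_permutations => tr; rewrite (chain_weight_rcons _ _ _ 0) //; last first.
    - exact: (allP s1).
    - by rewrite (perm_all _ tr).
    rewrite add0n (perm_sumn tr) addnC sumn_rem // scale_fun1 divr1; over.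
  rewrite -mulr_suml -mulr_sumr sum_permutations_arrangement_weight //.
  rewrite symmetry_factor_rem // size_rem // /c (big_rem x xs) /=; ring.
rewrite sum_undup_count -mulr_suml -natr_sum -sumnE /partition_weight /c /scale_fun.
have : (0 < sumn s)%N by case: s s0 s1 {c} => //= x s _ /andP[]; lia.
case: (sumn s) => // n _; rewrite factS natrM /=; ring.
Qed.

(** Numerator and denominator are multiplied by [theta + alpha], so that the block factors are again
    those of [theta]; in this form the weights for [theta] and [theta + alpha] can be compared. *)
Lemma partition_weight_shift theta s : - alpha < theta -> all (leq 1) s ->
  partition_weight (theta + alpha) s =
  symmetry_factor s * (sumn s)`!%:R * (\prod_(x <- s) box_weight alpha x)
  * new_block_prod theta (size s) / rising (theta + alpha) (sumn s).
Proof.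
move=> t0; case: s => [|x s] s1.
  by rewrite /partition_weight /new_block_prod /rising /= !big_ord0.
rewrite /partition_weight /new_block_prod /=.
have : (0 < x + sumn s)%N by move: s1 => /=; lia.
case: (x + sumn s)%N => // n _.
rewrite rising_recl big_ord_recl /= mul1r.
have -> : \prod_(i < size s) (theta + (bump 0 i).+1%:R * alpha) =
    \prod_(i < size s) (theta + alpha + i.+1%:R * alpha).
  by apply: eq_bigr => i _; rewrite /bump /= add1n -(natr1 i.+1); ring.
have h1 : theta + alpha != 0 by rewrite lt0r_neq0 //; lra.
have h2 : rising (theta + alpha + 1) n != 0.
  by rewrite lt0r_neq0 // rising_gt0 //; lra.
by rewrite (addrC 1); field; rewrite h1 h2.
Qed.

(** The mean of [W ^ a * (1 - W) ^ b] for [W] with the beta law of parameters [1 - alpha] and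
    [theta + alpha], that of the first stick. *)
Definition beta_moment (theta : R) (a b : nat) : R :=
  rising (1 - alpha) a * rising (theta + alpha) b / rising (1 + theta) (a + b).

(** Relative to the common constant [c], the event that the first stick receives no ball weighs
    [theta + k * alpha], and the event that its block is a given part [x] weighs [x - alpha]. The
    total [theta + n] cancels the last factor of [rising (1 + theta) n]. *)
Lemma partition_weight_rec theta s : - alpha < theta ->
  all (leq 1) s -> s != [::] ->
  partition_weight theta s =
  beta_moment theta 0 (sumn s) * partition_weight (theta + alpha) s
  + \sum_(x <- undup s) 'C(sumn s, x)%:R * beta_moment theta x (sumn s - x)
      * partition_weight (theta + alpha) (rem x s).
Proof.
move=> t0 s1 s0; move: (alpha_ge0) (alpha_lt1) => a0 a1.
have ta : 0 < theta + alpha by lra.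
have t1 : 0 < 1 + theta by lra.
have n0 : (0 < sumn s)%N by case: s s0 s1 => //= x s _ /andP[]; lia.
pose c := symmetry_factor s * (sumn s)`!%:R * (\prod_(x <- s) box_weight alpha x)
  * new_block_prod theta (size s).-1 / rising (1 + theta) (sumn s).
have -> : \sum_(x <- undup s) 'C(sumn s, x)%:R * beta_moment theta x (sumn s - x)
      * partition_weight (theta + alpha) (rem x s) =
    \sum_(x <- undup s) (count_mem x s)%:R * ((x%:R - alpha) * c).
  apply: eq_big_seq => x; rewrite mem_undup => xs.
  have rem1 : all (leq 1) (rem x s).
    by apply/allP => y /mem_rem; exact: (allP s1).
  have x1 : (0 < x)%N by exact: (allP s1).
  have xn : (x <= sumn s)%N by rewrite -(sumn_rem xs) leq_addr.
  rewrite partition_weight_shift // symmetry_factor_rem // size_rem //.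
  have -> : sumn (rem x s) = (sumn s - x)%N by rewrite -(sumn_rem xs) addKn.
  rewrite /beta_moment subnKC // /c (big_rem x xs) /=.
  have -> : (sumn s)`!%:R = 'C(sumn s, x)%:R * x`!%:R * (sumn s - x)`!%:R :> R.
    by rewrite -!natrM -mulnA bin_fact.
  have -> : rising (1 - alpha) x = (x%:R - alpha) * box_weight alpha x * x`!%:R.
    rewrite /box_weight -mulrA divfK ?pnatr_eq0 -?lt0n ?fact_gt0 //.
    by case: x x1 {xs rem1 xn} => // x _; rewrite risingS /= -natr1; ring.
  have h1 : rising (1 + theta) (sumn s) != 0 by rewrite lt0r_neq0 // rising_gt0.
  have h2 : rising (theta + alpha) (sumn s - x) != 0 by rewrite lt0r_neq0 // rising_gt0.
  by field; rewrite h1 h2.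
rewrite sum_undup_count -mulr_suml sumrB -natr_sum -sumnE sum_const_seq.
rewrite partition_weight_shift // /beta_moment /partition_weight add0n.
have h1 : rising (1 + theta) (sumn s).-1 != 0 by rewrite lt0r_neq0 // rising_gt0.
have h2 : rising (theta + alpha) (sumn s) != 0 by rewrite lt0r_neq0 // rising_gt0.
have -> : new_block_prod theta (size s) =
    new_block_prod theta (size s).-1 * (theta + (size s)%:R * alpha).
  by case: s s0 {s1 n0 c h1 h2} => // x s _; rewrite /new_block_prod big_ord_recr.
rewrite /c; have -> : rising (1 + theta) (sumn s) =
    rising (1 + theta) (sumn s).-1 * (theta + (sumn s)%:R).
  by case: (sumn s) n0 => // n _; rewrite risingS /= -natr1; ring.
have nr : 1 <= (sumn s)%:R :> R by rewrite ler1n.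
have h3 : theta + (sumn s)%:R != 0 by rewrite lt0r_neq0 //; lra.
rewrite -(mulr_natl alpha) /rising [in RHS]big_ord0 -!/(rising _ _).
by field; rewrite h1 h2 h3.
Qed.

End PartitionWeight.

(** * The composition of a Markov chain *)

(* The path [q] occupies the boxes [l] from its current state on, the last box
   being possibly larger. *)
Fixpoint fits (l : seq nat) (q : nat -> nat) : Prop :=
  if l is m :: l' then
    if nilp l' then is_true (q 0%N + m <= q 1%N)%N
    else q 1%N = (q 0%N + m)%N /\ fits l' (fun t => q t.+1)
  else True.

Lemma increasing_path_le (q : nat -> nat) : (forall t, (q t < q t.+1)%N) ->
  forall s t, (s <= t)%N -> (q s <= q t)%N.
Proof.
move=> qinc s t; elim: t => [|t IH]; first by rewrite leqn0 => /eqP ->.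
by rewrite leq_eqVlt => /orP[/eqP -> //|/IH]; have := qinc t; lia.
Qed.

(** The digits of a box of [m] balls say that nothing is visited strictly between [q 0] and
    [q 0 + m], hence only [q 0 + m <= q 1]. If another box follows, its leading digit 1 says that
    [q 0 + m] is visited, which forces equality. *)
Lemma binary_form_fits (q : nat -> nat) (l : seq nat) :
  (forall t, (q t < q t.+1)%N) -> all (leq 1) l -> l != [::] ->
  binary_form l = [seq `[< exists t, q t = j >] | j <- iota (q 0%N) (sumn l)] <->
  fits l q.
Proof.
elim: l q => // m l IH q qinc /= /andP[m0 l0] _.
have qmono := increasing_path_le qinc.
have visited0 j : (q 0%N < j)%N ->
    (exists t, q t = j) <-> exists t, q t.+1 = j.
  move=> j0; split=> [[[|t] tj]|[t tj]]; [lia|by exists t|by exists t.+1].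
have first_box : (true :: nseq m.-1 false =
    [seq `[< exists t, q t = j >] | j <- iota (q 0%N) m]) <-> (q 0%N + m <= q 1%N)%N.
  case: m m0 => // m _ /=.
  have -> : `[< exists t, q t = q 0%N >] by apply/asboolP; exists 0%N.
  split=> [[e]|qm].
    rewrite leqNgt; apply/negP => q1.
    have : false = `[< exists t, q t = q 1%N >].
      have iq : (q 1%N - (q 0%N).+1 < m)%N by have := qinc 0%N; lia.
      have := congr1 (fun s => nth false s (q 1%N - (q 0%N).+1)%N) e.
      rewrite nth_nseq iq (nth_map 0%N) ?size_iota // nth_iota // => ->.
      by rewrite subnKC.
    by move/esym/asboolP; apply; exists 1%N.
  congr cons; set v := map _ _.
  have -> : v = nseq (size v) false; last by rewrite size_map size_iota.
  apply/all_pred1P/allP => _ /mapP[j jm ->] /=; move: jm; rewrite mem_iota => jm.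
  apply/eqP/asboolP => -[[|t] tj]; first lia.
  by have := qmono 1%N t.+1 isT; lia.
have split_form : binary_form (m :: l) =
    [seq `[< exists t, q t = j >] | j <- iota (q 0%N) (m + sumn l)] <->
  (q 0%N + m <= q 1%N)%N /\
    binary_form l = [seq `[< exists t, q t.+1 = j >] | j <- iota (q 0%N + m) (sumn l)].
  rewrite iotaD map_cat.
  have -> : [seq `[< exists t, q t = j >] | j <- iota (q 0%N + m) (sumn l)] =
      [seq `[< exists t, q t.+1 = j >] | j <- iota (q 0%N + m) (sumn l)].
    apply/eq_in_map => j; rewrite mem_iota => jm; apply/asboolP/asboolP.
      by move/visited0; apply; lia.
    by move=> h; apply/visited0 => //; lia.
  rewrite -first_box /binary_form [map _ (m :: l)]/= [flatten (_ :: _)]/= -cat_cons.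
  split=> [/eqP|[-> ->] //].
  rewrite eqseq_cat; first by move=> /andP[/eqP -> /eqP ->].
  by rewrite /= size_nseq size_map size_iota prednK.
rewrite split_form; have [l_nil|l_cons] := boolP (nilp l).
  by rewrite (nilP l_nil) /=; split=> [[]|].
have l_neq : l != [::] by rewrite -size_eq0.
have IHq := IH (fun t => q t.+1) (fun t => qinc t.+1) l0 l_neq.
split=> [[qm e]|[q1 /IHq]]; last by rewrite q1 leqnn.
have q1 : q 1%N = (q 0%N + m)%N.
  case: l l0 l_neq e {IH split_form IHq l_cons} => // m' l /andP[m'0 _] _.
  case: m' m'0 => // m' _; rewrite /binary_form /= => -[/esym/asboolP[t tq] _].
  by have := qmono 1%N t.+1 isT; lia.
by split=> //; apply/IHq; rewrite q1.
Qed.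

Lemma probability_ae_eq d (T : measurableType d) (R : realType)
    (P : probability T R) (A B : set T) : measurable A -> measurable B ->
  {ae P, forall w, A w <-> B w} -> P A = P B.
Proof.
move=> mA mB AB; suff le (X Y : set T) : measurable X -> measurable Y ->
    {ae P, forall w, X w <-> Y w} -> (P X <= P Y)%E.
  apply/eqP; rewrite eq_le !le //.
  by apply: filterS AB => w [].
move=> mX mY [N [mN PN sub]].
have PY : P (Y `|` N) = P Y by rewrite measureU0.
rewrite -PY; apply: le_measure; rewrite ?inE //; first exact: measurableU.
move=> w Xw; have [Nw|nNw] := pselect (N w); first by right.
left; apply/not_notP => Yw; apply: nNw; apply: sub => /= XY; exact/Yw/XY.
Qed.

Section ChainComposition.
Variables (R : realType) (d : measure_display) (T : measurableType d)
  (P : probability T R) (Q : nat -> {RV P >-> nat}) (p : nat -> nat -> R).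
Hypothesis chain : increasing_markov_chain Q p.

Let prefix t (x : nat -> nat) : set T :=
  [set w | forall s, (s <= t)%N -> Q s w = x s].

Let measurable_state s (A : set nat) : measurable [set w | A (Q s w)].
Proof. exact: (@measurable_funPTI _ _ _ _ (Q s)). Qed.

Let measurable_prefix t x : measurable (prefix t x).
Proof.
have -> : prefix t x = \bigcap_(s in `I_t.+1) [set w | [set x s] (Q s w)] by [].
by apply: bigcap_measurable => [|s _]; [exists 0%N|exact: measurable_state].
Qed.

Let extend t (x : nat -> nat) j := fun s => if (s <= t)%N then x s else j.

Let prefix_extend t x j :
  prefix t.+1 (extend t x j) = prefix t x `&` [set w | Q t.+1 w = j].
Proof.
apply/seteqP; split=> w /=.
  move=> h; split=> [s st|]; last by rewrite h // /extend ltnn.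
  by rewrite h ?(leq_trans st) // /extend st.
move=> [h hj] s; rewrite leq_eqVlt ltnS /extend => /orP[/eqP ->|st].
  by rewrite ltnn.
by rewrite st h.
Qed.

Let prob_prefix_extend t x j : (forall s, (s <= t)%N -> (0 < x s)%N) -> (0 < j)%N ->
  P (prefix t x `&` [set w | Q t.+1 w = j]) = (P (prefix t x) * (p (x t) j)%:E)%E.
Proof.
move=> x0 j0; have [_ _ _ _ step] := chain.
rewrite -prefix_extend /prefix step; last first.
  by move=> s _; rewrite /extend; case: ifP => [/x0|].
rewrite /extend leqnn ltnn; congr (P _ * _)%E.
by apply/seteqP; split=> w /= h s st; have := h _ st; rewrite st.
Qed.

Let measurable_fits t l : measurable [set w | fits l (fun s => Q (t + s)%N w)].
Proof.
elim: l t => [|m l IH] t /=; first exact: measurableT.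
case: nilp.
  have -> : [set w | (Q (t + 0)%N w + m <= Q (t + 1)%N w)%N] =
    \bigcup_k ([set w | [set k] (Q (t + 0)%N w)] `&`
      [set w | [set j | (k + m <= j)%N] (Q (t + 1)%N w)]).
    apply/seteqP; split=> w /=; first by move=> h; exists (Q (t + 0)%N w).
    by move=> [k _ [/= ->]].
  by apply: bigcup_measurable => k _; apply: measurableI; exact: measurable_state.
have -> : [set w | Q (t + 1)%N w = (Q (t + 0)%N w + m)%N /\
      fits l (fun s => Q (t + s.+1)%N w)] =
    \bigcup_k ([set w | [set k] (Q (t + 0)%N w)] `&`
      [set w | [set (k + m)%N] (Q (t + 1)%N w)]) `&`
    [set w | fits l (fun s => Q (t.+1 + s)%N w)].
  have E w : (fun s => Q (t + s.+1)%N w) = (fun s => Q (t.+1 + s)%N w).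
    by apply/funext => s; rewrite addnS.
  apply/seteqP; split=> w /=; rewrite E.
    by move=> [h ?]; split=> //; exists (Q (t + 0)%N w).
  by move=> [[k _ [/= -> ->]]].
apply: measurableI; last exact: IH.
by apply: bigcup_measurable => k _; apply: measurableI; exact: measurable_state.
Qed.

(** The chain gives probabilities of single next states only, so the tail event is reached from
    [m = 1], where strict increase makes it almost sure, by removing one value at a time. *)
Let prob_last_box t x m : (forall s, (s <= t)%N -> (0 < x s)%N) -> (0 < m)%N ->
  P (prefix t x `&` [set w | [set j | (x t + m <= j)%N] (Q t.+1 w)]) =
  (P (prefix t x) * (chain_weight p (x t) [:: m])%:E)%E.
Proof.
move=> x0; case: m => // m _; elim: m => [|m IH].
  rewrite chain_weight_unit mule1; apply: probability_ae_eq => //.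
    by apply: measurableI => //; exact: measurable_state.
  have [_ _ _ inc _] := chain; apply: filterS inc => w inc.
  split=> [[]//|h]; split=> //=.
  by rewrite -(h t (leqnn t)) addn1.
set A := _ `&` _ in IH *.
have AE : A = (prefix t x `&` [set w | Q t.+1 w = (x t + m.+1)%N]) `|`
    (prefix t x `&` [set w | [set j | (x t + m.+2 <= j)%N] (Q t.+1 w)]).
  rewrite -setIUr; congr (_ `&` _); apply/seteqP; split=> w /=.
    rewrite leq_eqVlt => /orP[/eqP ->|h]; [by left|right; lia].
  by move=> [->//|]; lia.
have mU j := measurableI _ _ (measurable_prefix t x) (measurable_state t.+1 j).
have PA : P A = (P (prefix t x `&` [set w | Q t.+1 w = (x t + m.+1)%N]) +
    P (prefix t x `&` [set w | [set j | (x t + m.+2 <= j)%N] (Q t.+1 w)]))%E.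
  rewrite AE measureU //; first exact: (mU [set (x t + m.+1)%N]).
  by apply/seteqP; split=> w //= -[[_ ->] [_]]; lia.
move: PA; rewrite IH prob_prefix_extend //; last by lia.
set B := P (prefix t x `&` _).
have : P (prefix t x) \is a fin_num by rewrite fin_num_measure.
have : B \is a fin_num by rewrite fin_num_measure //; exact: (mU [set j | (x t + m.+2 <= j)%N]).
case: B => // b _; case: (P (prefix t x)) => // a _.
rewrite -!EFinM -EFinD => -[] e; congr EFin.
rewrite transition_chain_weight // in e.
by move/esym/(canRL (addKr _)): e => ->; ring.
Qed.

Let prob_fits l t x : (forall s, (s <= t)%N -> (0 < x s)%N) ->
  all (leq 1) l -> l != [::] ->
  P (prefix t x `&` [set w | fits l (fun s => Q (t + s)%N w)]) =
  (P (prefix t x) * (chain_weight p (x t) l)%:E)%E.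
Proof.
move=> x0; elim: l t x x0 => // m [|m' l] IH t x x0 /andP[m0 l0] _.
  rewrite -prob_last_box //; congr (P _); apply/seteqP; split=> w [h f];
    by have ht := h t (leqnn t); split=> //; move: f; rewrite /= addn0 addn1 ht.
have xm0 : (0 < x t + m)%N by rewrite addn_gt0 x0.
have -> : chain_weight p (x t) [:: m, m' & l] =
  p (x t) (x t + m)%N * chain_weight p (x t + m) (m' :: l) by [].
rewrite EFinM muleA -prob_prefix_extend // -prefix_extend.
have -> : chain_weight p (x t + m) (m' :: l) =
    chain_weight p (extend t x (x t + m)%N t.+1) (m' :: l).
  by rewrite /extend ltnn.
rewrite -IH //; last by move=> s _; rewrite /extend; case: ifP => [/x0|].
rewrite prefix_extend; congr (P _).
have E w : (fun s => Q (t + s.+1)%N w) = (fun s => Q (t.+1 + s)%N w).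
  by apply/funext => s; rewrite addnS.
have step q : fits [:: m, m' & l] q =
  (q 1%N = (q 0%N + m)%N /\ fits (m' :: l) (fun t => q t.+1)) by [].
apply/seteqP; split=> w.
  move=> [h]; have ht := h t (leqnn t).
  by rewrite /mkset step E addn0 addn1 ht => -[q1 f].
move=> [[h q1] f]; have ht := h t (leqnn t); split=> //.
by rewrite /mkset step E addn0 addn1 ht.
Qed.

(** Stated for an arbitrary increasing chain: existence applies it to the explicit chain, uniqueness
    to whichever chain represents a competing structure. *)
Lemma chain_composition_prob n (l : seq nat) : (0 < n)%N -> is_composition n l ->
  P [set w | binary_form l = [seq visits Q w j | j <- iota 1 n]] =
  (chain_weight p 1 l)%:E.
Proof.
move=> n0 /andP[l1 /eqP ln]; have [_ _ start inc _] := chain.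
have l_neq : l != [::] by apply/eqP => l0; move: n0; rewrite -ln l0.
have start1 : P (prefix 0 (fun=> 1%N)) = 1%E.
  rewrite -(@probability_setT _ _ _ P); apply: probability_ae_eq => //.
  apply: filterS start => w q0; split=> // _ s.
  by rewrite leqn0 => /eqP ->.
have -> : (chain_weight p 1 l)%:E =
    P (prefix 0 (fun=> 1%N) `&` [set w | fits l (fun s => Q (0 + s)%N w)]).
  by rewrite prob_fits // start1 mul1e.
apply: probability_ae_eq.
- have -> : [set w | binary_form l = [seq visits Q w j | j <- iota 1 n]] =
      [set w | forall i, (i < n)%N -> nth false (binary_form l) i = visits Q w i.+1].
    have szl : size (binary_form l) = n.
      rewrite -ln; elim: (l) l1 => //= m l' IH /andP[m0 /IH].
      by rewrite /binary_form /= size_cat size_nseq => ->; lia.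
    apply/seteqP; split=> w /=.
      move=> -> i iltn; rewrite (nth_map 0%N) ?size_iota // nth_iota //.
    move=> h; apply: (@eq_from_nth _ false); rewrite szl ?size_map ?size_iota //.
    by move=> i iltn; rewrite (nth_map 0%N) ?size_iota // nth_iota // h.
  have -> : [set w | forall i, (i < n)%N -> nth false (binary_form l) i = visits Q w i.+1] =
      \bigcap_(i in `I_n) [set w | nth false (binary_form l) i = visits Q w i.+1] by [].
  apply: bigcap_measurable => [|i _]; first by exists 0%N.
  have mv : measurable [set w | visits Q w i.+1].
    have -> : [set w | visits Q w i.+1] = \bigcup_t [set w | [set i.+1] (Q t w)].
      apply/seteqP; split=> w /=; first by move=> /asboolP[t tq]; exists t.
      by move=> [t _ /= tq]; apply/asboolP; exists t.
    by apply: bigcup_measurable => t _; exact: measurable_state.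
  case: (nth _ _ _).
    by congr measurable: mv; apply/seteqP; split=> w /= => [->|<-].
  have := measurableC mv; congr measurable; apply/seteqP; split=> w /=.
    by move/negP; case: visits.
  by move=> <-.
- by apply: measurableI => //; exact: measurable_fits.
- apply: filterS2 start inc => w q0 inc.
  have := binary_form_fits inc l1 l_neq; rewrite q0 ln => e; split=> [/e f|[_ /e]] //.
  by split=> // s; rewrite leqn0 => /eqP ->.
Qed.

End ChainComposition.

(** * Existence of the chain *)

(* The chain is read off a uniform variable [v] on ]0, 1]: from state [i] it
   jumps by the [m] with [G i (m + 1) < v <= G i m], and [v] is then rescaled
   to ]0, 1] to be used for the next jump. *)
Section ChainExistence.
Variables (R : realType) (G : nat -> nat -> R).
Hypotheses (G1 : forall i, G i 1 = 1)
  (G_decr : forall i m, (0 < m)%N -> G i m.+1 < G i m)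
  (G_ge0 : forall i m, 0 <= G i m)
  (G_cvg0 : forall i, G i @ \oo --> (0 : R)).

Definition jump_prob (i j : nat) : R :=
  if (i < j)%N then G i (j - i) - G i (j - i).+1 else 0.

Definition jump_set (i : nat) (v : R) : set nat :=
  [set m | (0 < m)%N /\ G i m.+1 < v <= G i m].

(** The default 0 is met only when no [m] qualifies, which never happens for [v] in ]0, 1]. *)
Definition jump (i : nat) (v : R) : nat := xget 0%N (jump_set i v).

Definition rescale (i m : nat) (v : R) : R :=
  (v - G i m.+1) / (G i m - G i m.+1).

Definition chain_step (s : nat * R) : nat * R :=
  ((s.1 + jump s.1 s.2)%N, rescale s.1 (jump s.1 s.2) s.2).

Definition chain_state (t : nat) (w : R) : nat * R := iter t chain_step (1%N, w).

Let G_le i m m' : (0 < m)%N -> (m <= m')%N -> G i m' <= G i m.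
Proof.
move=> m0; elim: m' => [|m' IH]; first by move=> h; move: m0; rewrite lt0n -leqn0 h.
rewrite leq_eqVlt => /orP[/eqP -> //|mm']; apply: le_trans (IH mm').
by apply/ltW/G_decr/(leq_trans m0).
Qed.

Let jump_eq i m v : jump_set i v m -> jump i v = m.
Proof.
move=> hm; apply: xget_subset1 => // {hm} m1 m2 [m10 /andP[l1 r1]] [m20 /andP[l2 r2]].
have [h|h|//] := ltngtP m1 m2.
  by have := le_lt_trans (le_trans r2 (G_le i (ltn0Sn m1) h)) l1; rewrite ltxx.
by have := le_lt_trans (le_trans r1 (G_le i (ltn0Sn m2) h)) l2; rewrite ltxx.
Qed.

Let jump_setP i v : 0 < v <= 1 -> jump_set i v (jump i v).
Proof.
move=> /andP[v0 v1].
(* Jumps are at least 1: the jump is [m.+1] for the least such [m], and the case [m = 0] is closed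
   by [G i 1 = 1]. *)
have ex : exists m, G i m.+2 < v.
  have [N _ h] : \forall m \near \oo, `|0 - G i m| < v.
    by move: (G_cvg0 i) => /cvgrPdist_lt /(_ v v0).
  have Nle : (N <= N.+2)%N by lia.
  exists N; have := h N.+2 Nle.
  by rewrite sub0r normrN ger0_norm.
have [m hm min] := ex_minnP ex.
rewrite (@jump_eq i m.+1) //; split=> //.
all: rewrite hm /=; case: m hm min => [|m] hm min; first by rewrite G1.
all: by rewrite leNgt; apply/negP => /min; rewrite ltnn.
Qed.

Let rescale_itv i m v : (0 < m)%N -> G i m.+1 < v <= G i m -> 0 < rescale i m v <= 1.
Proof.
move=> m0 /andP[v0 v1]; have d0 : 0 < G i m - G i m.+1 by rewrite subr_gt0 G_decr.
apply/andP; split; first by rewrite divr_gt0 // subr_gt0.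
by rewrite /rescale ler_pdivrMr // mul1r lerD2r.
Qed.

Let chain_stateS t w : chain_state t.+1 w = chain_step (chain_state t w).
Proof. by []. Qed.

Let chain_state_itv t w : 0 < w <= 1 -> 0 < (chain_state t w).2 <= 1.
Proof.
move=> w01; elim: t => // t IH; rewrite chain_stateS /=.
by have [m0 ?] := jump_setP (chain_state t w).1 IH; exact: rescale_itv.
Qed.

Let chain_state_incr t w : 0 < w <= 1 -> ((chain_state t w).1 < (chain_state t.+1 w).1)%N.
Proof.
move=> w01; rewrite chain_stateS /=.
have [m0 _] := jump_setP (chain_state t w).1 (chain_state_itv t w01).
by rewrite -{1}(addn0 (chain_state t w).1) ltn_add2l.
Qed.

Let measurable_jump i m : measurable [set v | jump i v = m].
Proof.
have mpos k : (0 < k)%N -> measurable (jump_set i ^~ k).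
  move=> k0; have -> : jump_set i ^~ k = `]G i k.+1, G i k]%classic.
    apply/seteqP; split=> v /=; rewrite in_itv /=; first by move=> [].
    by move=> ?; split.
  exact: measurable_itv.
case: m => [|m].
  have -> : [set v | jump i v = 0%N] = ~` \bigcup_k (jump_set i ^~ k.+1).
    apply/seteqP; split=> v /=.
      by move=> j0 [k _ /= /jump_eq]; rewrite j0.
    move=> h; rewrite /jump; case: xgetP => // k _ kin.
    case: k kin => // k kin; exfalso; apply: h; exists k => //.
  by apply: measurableC; apply: bigcup_measurable => k _; exact: mpos.
have -> : [set v | jump i v = m.+1] = jump_set i ^~ m.+1; last exact: mpos.
apply/seteqP; split=> v /=; last exact: jump_eq.
by rewrite /jump; case: xgetP => // k -> h <-.
Qed.

Let measurable_chain_state t x (A : set R) : measurable A ->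
  measurable [set w | (chain_state t w).1 = x /\ A (chain_state t w).2].
Proof.
elim: t x A => [|t IH] x A mA /=.
  have [->|x1] := eqVneq x 1%N.
    by congr measurable: mA; apply/seteqP; split=> w /= => [|[]].
  rewrite (_ : mkset _ = set0) //; apply/seteqP; split=> w //= [] h.
  by move/eqP: x1; rewrite h.
have -> : [set w | (chain_state t.+1 w).1 = x /\ A (chain_state t.+1 w).2] =
  \bigcup_i \bigcup_(m in [set m | (i + m)%N = x])
    [set w | (chain_state t w).1 = i /\
      ([set v | jump i v = m] `&` (rescale i m @^-1` A)) (chain_state t w).2].
  apply/seteqP; split=> w; rewrite /mkset chain_stateS /=.
    move=> [xE Aw]; exists (chain_state t w).1 => //.
    by exists (jump (chain_state t w).1 (chain_state t w).2).
  by move=> [i _ [m mx [iE [/= mE Aw]]]]; rewrite iE mE.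
apply: bigcup_measurable => i _; apply: bigcup_measurable => m _; apply: IH.
apply: measurableI; first exact: measurable_jump.
rewrite -[X in measurable X]setTI; apply: (_ : measurable_fun setT (rescale i m)) => //.
apply: measurable_funM => //; apply: measurable_funB => //.
Qed.

Let unif : probability _ R := uniform_prob (@ltr01 R).

Let unif_itv (a b : R) : 0 <= a -> a <= b -> b <= 1 -> unif `]a, b]%classic = (b - a)%:E.
Proof.
move=> a0 ab b1; rewrite /unif /= /uniform_prob.
rewrite (eq_integral (fun=> 1%E)).
  rewrite integral_cst //= mul1e lebesgue_measure_itv /= lte_fin.
  by case: ltgtP ab => // -> _; rewrite subrr.
move=> v; rewrite inE /= in_itv /= => /andP[av vb].
rewrite /uniform_pdf subr0 invr1 (le_trans a0 (ltW av)) (le_trans vb b1) //.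
Qed.

Let unif_01 (A : set R) : measurable A -> unif (`]0, 1]%classic `&` A) = unif A.
Proof.
move=> mA; have m01 : measurable (`]0, 1]%classic : set R) by exact: measurable_itv.
apply: probability_ae_eq => //; first exact: measurableI.
exists (~` `]0, 1]%classic); split; first exact: measurableC.
  by rewrite probability_setC // unif_itv // subr0 -EFinB subrr.
by move=> w /= h w01; apply: h; split=> [[]|].
Qed.

Let cylinder t (x : nat -> nat) (a b : R) : set R :=
  `]0, 1]%classic `&` [set w | (forall s, (s <= t)%N -> (chain_state s w).1 = x s) /\
     a < (chain_state t w).2 <= b].

(** The free interval ][a], [b]] records that, given the path, the rescaled variable is still
    uniform. Pulled back along the last jump it becomes an interval shorter by the factor [q], the
    probability of that jump, so the induction closes. *)
Let cylinder_prob t x a b : x 0%N = 1%N -> 0 <= a -> a <= b -> b <= 1 ->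
  unif (cylinder t x a b) =
  (\prod_(s < t) jump_prob (x s) (x s.+1) * (b - a))%:E.
Proof.
move=> x0; elim: t a b => [|t IH] a b a0 ab b1.
  rewrite big_ord0 mul1r -unif_itv //; congr (unif _); apply/seteqP; split=> w /=.
    by move=> [_ [_ ?]]; rewrite in_itv.
  rewrite in_itv /= => /andP[aw wb]; split.
    by rewrite /= in_itv /= (le_lt_trans a0 aw) (le_trans wb b1).
  by split=> [s|]; [rewrite leqn0 => /eqP ->|rewrite aw wb].
rewrite big_ord_recr /=; have [xt|xt] := ltnP (x t) (x t.+1); last first.
  rewrite {2}/jump_prob ltnNge xt /= mulr0 mul0r.
  have -> : cylinder t.+1 x a b = set0; last by rewrite measure0.
  apply/seteqP; split=> w //= [w01 [h _]].
  move: w01; rewrite /= in_itv => /(chain_state_incr t).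
  by rewrite !h // ltnNge xt.
rewrite {2}/jump_prob xt; set m := (x t.+1 - x t)%N.
have m0 : (0 < m)%N by rewrite subn_gt0.
set g := G (x t) m.+1; set q := G (x t) m - g.
have q0 : 0 < q by rewrite subr_gt0 G_decr.
have g0 : 0 <= g by exact: G_ge0.
have gq1 : g + q <= 1 by rewrite /q addrC subrK -(G1 (x t)) G_le.
have -> : cylinder t.+1 x a b = cylinder t x (g + a * q) (g + b * q).
  have resc v : (a < rescale (x t) m v <= b) = (g + a * q < v <= g + b * q).
    by rewrite /rescale ltr_pdivlMr // ler_pdivrMr // ltrBrDl lerBlDl.
  apply/seteqP; split=> w [w01 [h vab]]; split=> //.
    have stw : (chain_state t w).1 = x t by exact: h.
    have jm : jump (x t) (chain_state t w).2 = m.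
      have := h t.+1 (leqnn _); rewrite chain_stateS /= stw /m => <-.
      by rewrite addKn.
    split=> [s st|]; first by apply: h; rewrite ltnW.
    by move: vab; rewrite chain_stateS /= stw jm resc.
  have stw : (chain_state t w).1 = x t by exact: h.
  have jm : jump (x t) (chain_state t w).2 = m.
    apply: jump_eq; split=> //; move: vab => /andP[v1 v2].
    rewrite (le_lt_trans _ v1) ?lerDl ?mulr_ge0 ?(ltW q0) //=.
    apply: (le_trans v2); rewrite -lerBrDl -/q -[leRHS]mul1r ler_wpM2r //.
    exact: ltW.
  split=> [s|]; last by rewrite chain_stateS /= stw jm resc.
  rewrite leq_eqVlt => /orP[/eqP ->|]; last by exact: h.
  by rewrite chain_stateS /= stw jm subnKC // ltnW.
rewrite IH.
- by rewrite /jump_prob -/m -/g -/q; congr EFin; ring.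
- by rewrite addr_ge0 // mulr_ge0 // ltW.
- by rewrite lerD2l ler_wpM2r // ltW.
- apply: le_trans gq1; rewrite lerD2l -[leRHS]mul1r ler_wpM2r //.
  exact: ltW.
Qed.

Let measurable_chain t : measurable_fun setT (fun w => (chain_state t w).1).
Proof.
move=> _ Y _; rewrite setTI.
have -> : (fun w => (chain_state t w).1) @^-1` Y =
  \bigcup_(x in Y) [set w | (chain_state t w).1 = x /\ setT (chain_state t w).2].
  apply/seteqP; split=> w /=; first by exists (chain_state t w).1.
  by move=> [x Yx [-> _]].
by apply: bigcup_measurable => x _; exact: measurable_chain_state.
Qed.

Lemma jump_prob_series i : (\sum_(1 <= j <oo) (jump_prob i j)%:E = 1)%E.
Proof.
have G_shift : (fun n => 1 - G i n.+1) @ \oo --> (1 : R).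
  rewrite -[X in _ --> X]subr0; apply: cvgB; first exact: cvg_cst.
  by rewrite cvg_shiftS.
have part n : \sum_(1 <= j < (n + i).+1) jump_prob i j = 1 - G i n.+1.
  elim: n => [|n IH].
    rewrite G1 subrr big_nat big1 // => j /andP[_ ji].
    by rewrite /jump_prob ltnNge -ltnS ji.
  rewrite addSn big_nat_recr //= IH /jump_prob ltnS leq_addl.
  rewrite (_ : ((n + i).+1 - i)%N = n.+1); [ring|lia].
apply/cvg_lim => //; rewrite -(cvg_shiftn i.+1).
have -> : (fun n => \sum_(1 <= j < n + i.+1) (jump_prob i j)%:E)%E =
    (fun n => (1 - G i n.+1)%:E).
  by apply/funext => n; rewrite addnS sumEFin part.
by apply: cvg_EFin; [exact: nearW|exact: G_shift].
Qed.

Lemma chain_exists : exists (d : measure_display) (T : measurableType d)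
    (P : probability T R) (Q : nat -> {RV P >-> nat}),
  increasing_markov_chain Q jump_prob.
Proof.
have mX t : measurable_fun (setT : set (measurableTypeR R))
    (fun w => (chain_state t w).1) by exact: measurable_chain.
pose X t : {mfun measurableTypeR R >-> nat} := MeasurableFun.Pack
  (MeasurableFun.Class (isMeasurableFun.Build _ _ _ _ _ (mX t))).
exists _, _, unif, X.
split.
- move=> i j _ _; rewrite /jump_prob; case: ifP => // ij.
  by rewrite subr_ge0 ltW // G_decr // subn_gt0.
- by move=> i _; exact: jump_prob_series.
- exact: aeW.
- exists (~` `]0, 1]%classic); split; first by apply: measurableC; exact: measurable_itv.
    by rewrite probability_setC // unif_itv // subr0 -EFinB subrr.
  by move=> w /= h w01; apply: h => t; apply: chain_state_incr; rewrite in_itv in w01.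
- move=> t x xpos.
  have mprefix u : measurable [set w | forall s, (s <= u)%N -> X s w = x s].
    have -> : [set w | forall s, (s <= u)%N -> X s w = x s] =
      \bigcap_(s in `I_u.+1) [set w | (chain_state s w).1 = x s /\ setT (chain_state s w).2].
      by apply/seteqP; split=> w /= h s su; [split=> //; exact: h|have [] := h s su].
    apply: bigcap_measurable => [|s _]; first by exists 0%N.
    exact: measurable_chain_state.
  have prefixE u : unif [set w | forall s, (s <= u)%N -> X s w = x s] =
      unif (cylinder u x 0 1).
    rewrite -unif_01; last exact: mprefix.
    congr (unif _); apply/seteqP; split=> w [w01 h]; split=> //.
      by split=> //; apply: chain_state_itv; move: w01; rewrite /= in_itv.
    by case: h.
  rewrite !prefixE; have [x0|x0] := eqVneq (x 0%N) 1%N.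
    by rewrite !cylinder_prob // !subr0 !mulr1 big_ord_recr /= EFinM.
  have cyl0 u : cylinder u x 0 1 = set0.
    apply/seteqP; split=> w //= [_ [h _]]; move/eqP: x0; apply.
    by rewrite -(h 0%N).
  by rewrite !cyl0 measure0 mul0e.
Qed.

End ChainExistence.

(** * The tails of the explicit chain tend to 0 *)

Section TailProb.
Variables (R : realType) (alpha theta : R).
Hypotheses (alpha_ge0 : 0 <= alpha) (alpha_lt1 : alpha < 1)
  (theta_gt : - alpha < theta).

Let tail := tail_prob alpha theta.
Let trans := trans_prob alpha theta.

Let tailE i m : trans i (i + m.+1)%N = tail i m.+1 - tail i m.+2.
Proof. by rewrite /trans /trans_prob addnS ltnS leq_addr -addnS addKn. Qed.

(** A jump has, relative to the tail beyond it, probability at least of order [1 / m]. Divergence of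
    the harmonic series then forces the tail to 0, with no asymptotics of rising factorials. *)
Let trans_lower i m : (0 < i)%N ->
  tail i m.+2 * ((theta + alpha) / i.+1%:R * m.+1%:R^-1) <= trans i (i + m.+1)%N.
Proof.
move=> i0; move: (alpha_ge0) (alpha_lt1) (theta_gt) => a0 a1 t0.
rewrite /trans trans_probE // /tail /tail_prob.
rewrite (@box_weightS _ _ m.+1) // !addnS /=.
set h := scale_fun _ _ / _; set w := box_weight _ _.
have h0 : 0 < h by apply: divr_gt0; exact: (scale_fun_gt0 a1 t0).
have w0 : 0 < w by apply: box_weight_gt0.
set M := m.+1%:R; set s := (i + m)%:R.
have M1 : 1 <= M by rewrite ler1n.
have Ms : M <= s by rewrite ler_nat; lia.
(* Origin of the factor [1 / (i + 1)]: it bounds [M / s] from below uniformly in [m]. *)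
have sM : s <= i.+1%:R * M by rewrite -natrM ler_nat; nia.
have i1 : 0 < i.+1%:R :> R by [].
have m2 : m.+2%:R != 0 :> R by [].
have -> : h * (m.+2%:R * ((M - alpha) * w / m.+2%:R)) *
    ((theta + alpha) / i.+1%:R * M^-1) =
    h * (w * ((M - alpha) / M * ((theta + alpha) / i.+1%:R))).
  by field; rewrite !lt0r_neq0 //; lra.
rewrite !ler_pM2l //.
have s0 : 0 < s by lra.
apply: (@le_trans _ _ ((theta + alpha) / i.+1%:R)).
  rewrite ler_piMl ?divr_ge0 //; first lra.
  by rewrite ler_pdivrMr; lra.
apply: (@le_trans _ _ ((theta + alpha) * M / s)).
  rewrite -mulrA ler_wpM2l //; first lra.
  by rewrite ler_pdivlMr // mulrC ler_pdivrMr // mulrC.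
have -> : alpha + theta * M / s = (alpha * s + theta * M) / s.
  by rewrite mulrDl mulfK // lt0r_neq0.
by rewrite ler_pM2r ?invr_gt0 // mulrDl addrC lerD2r ler_wpM2l.
Qed.

(** Each step lowers the tail by at least [e / (m + 1)] times its new value, which pays for the
    growth of the harmonic factor. *)
Let tail_harmonic i m : (0 < i)%N ->
  (1 + (theta + alpha) / i.+1%:R * series harmonic m) * tail i m.+1 <= 1.
Proof.
move=> i0; move: (alpha_ge0) (alpha_lt1) (theta_gt) => a0 a1 t0.
elim: m => [|m IH].
  by rewrite /series /= big_geq // mulr0 addr0 mul1r /tail tail_prob1.
rewrite seriesSr /=; set e := (theta + alpha) / _ in IH *.
have e0 : 0 < e by rewrite divr_gt0 //; lra.
set S := series _ _ in IH *.
have S0 : 0 <= e * S.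
  by rewrite mulr_ge0 ?(ltW e0) // sumr_ge0 // => k _; rewrite invr_ge0.
have := trans_lower m i0; rewrite tailE -/e.
have : 0 <= trans i (i + m.+1)%N by apply: trans_prob_ge0.
rewrite tailE; set u := tail i m.+1 in IH *; set v := tail i m.+2.
move=> vu h; have : e * S * v <= e * S * u by rewrite ler_wpM2l //; lra.
have IH' : u + e * S * u <= 1 by rewrite -[X in X + _]mul1r -mulrDl.
set dlt := m.+1%:R^-1 in h *.
have -> : (1 + e * (S + dlt)) * v = v + e * S * v + v * (e * dlt) by ring.
by lra.
Qed.

Lemma tail_prob_cvg0 i : (0 < i)%N -> tail_prob alpha theta i @ \oo --> (0 : R).
Proof.
move=> i0; move: (alpha_ge0) (alpha_lt1) (theta_gt) => a0 a1 t0.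
rewrite -cvg_shiftS /=.
have Soo : series (@harmonic R) @ \oo --> +oo%R.
  apply: nondecreasing_dvgn_lt; last exact: dvg_harmonic.
  by apply: nondecreasing_series => k _ _; exact: harmonic_ge0.
apply/cvgrPdist_le => e e0.
set c := (theta + alpha) / i.+1%:R.
have c0 : 0 < c by rewrite divr_gt0 //; lra.
have [N _ SN] : \forall n \near \oo, (c * e)^-1 <= series (@harmonic R) n.
  by move/cvgryPge: Soo; exact.
exists N => // n /= Nn; have {SN}Sn := SN n Nn.
have u0 : 0 < tail i n.+1 by exact: tail_prob_gt0.
rewrite sub0r normrN gtr0_norm //.
have Sn0 : 0 < (c * e)^-1 by rewrite invr_gt0 mulr_gt0.
have h1 : c * series harmonic n * tail i n.+1 <= 1.
  by have := tail_harmonic n i0; rewrite -/c mulrDl mul1r; lra.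
have h2 : c * (c * e)^-1 * tail i n.+1 <= 1.
  by apply: le_trans h1; rewrite ler_pM2r // ler_pM2l.
by move: h2; rewrite invfM mulVKf ?lt0r_neq0 // mulrC ler_pdivrMr // mul1r.
Qed.

Lemma ss_markov_chain_exists : exists (d : measure_display) (T : measurableType d)
    (P : probability T R) (Q : nat -> {RV P >-> nat}),
  increasing_markov_chain Q (trans_prob alpha theta).
Proof.
(* [chain_exists] asks its conditions of every [i], so state 0 borrows the row of state 1; the chain
   starts at 1 and never meets it. *)
pose G i m := tail_prob alpha theta (maxn i 1) m.
have [||||d [T [P [Q [p0 p1 start inc step]]]]] := @chain_exists R G.
- by move=> i; exact: tail_prob1.
- move=> i [|m] // _; rewrite -subr_gt0 /G -tailE.
  by apply: trans_prob_gt0 => //; lia.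
- move=> i [|m]; first by rewrite /G /tail_prob mul0r mulr0.
  by apply/ltW/tail_prob_gt0.
- by move=> i; apply: tail_prob_cvg0; lia.
exists d, T, P, Q.
have pE i j : (0 < i)%N -> trans_prob alpha theta i j = jump_prob G i j.
  by move=> i0; rewrite /trans_prob /jump_prob /G (maxn_idPl i0).
split=> //.
- by move=> i j i0 j0; rewrite pE // p0.
- by move=> i i0; rewrite -(p1 i) //; apply: eq_eseriesr => j _; rewrite pE.
- by move=> t x x0; rewrite step // pE // x0.
Qed.

End TailProb.

(** * Existence and uniqueness of the self-similar Markov structure *)

Lemma ss_markov_pmf_self_similar (R : realType) (alpha theta : R) :
  0 <= alpha -> alpha < 1 -> - alpha < theta ->
  self_similar_markov (ss_markov_pmf alpha theta).
Proof.
move=> a0 a1 t0; split; first exact: ss_markov_composition_structure.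
have [d [T [P [Q chain]]]] := ss_markov_chain_exists a0 a1 t0.
exists d, T, P, Q, (trans_prob alpha theta); split=> // n n1 l.
by rewrite (chain_composition_prob chain n1 (partsP l)).
Qed.

(** Consistency of [C] is an identity between weights of any chain representing it, so
    [chain_weight_unique] applies and leaves the one-part compositions as the only data. *)
Lemma self_similar_markov_unique (R : realType) (alpha theta : R)
    (C : forall n, composition n -> R) :
  0 <= alpha -> alpha < 1 -> - alpha < theta -> self_similar_markov C ->
  (forall n (l : composition n), (1 <= n)%N -> l = [:: n] :> seq nat ->
    C n l = ss_markov_pmf alpha theta l) ->
  forall n (l : composition n), (1 <= n)%N -> C n l = ss_markov_pmf alpha theta l.
Proof.
move=> a0 a1 t0 [[_ Cdel] [d [T [P [Q [p [chain Cp]]]]]]] C1.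
have CE n (l : composition n) : (1 <= n)%N -> C n l = chain_weight p 1 l.
  by move=> n1; apply/EFin_inj; rewrite Cp // (chain_composition_prob chain n1 (partsP l)).
have pE : forall l, all (leq 1) l ->
    chain_weight (trans_prob alpha theta) 1 l = chain_weight p 1 l.
  apply: chain_weight_unique.
  - by move=> i j; exact: trans_prob_gt0.
  - by move=> mu mu1 mu0; exact: sum_grow_chain_weight.
  - move=> mu mu1 mu0.
    have n0 : (0 < sumn mu)%N by case: mu mu1 mu0 => //= x s /andP[]; lia.
    have muP : is_composition (sumn mu) mu by rewrite /is_composition mu1 /=.
    have := Cdel (sumn mu).+1 n0 (Composition muP : composition (sumn mu).+1.-1).
    rewrite CE //= => ->; under [X in _ = _ * X]eq_bigr => l _ do rewrite CE //.
    have := @deletion_sum R (sumn mu).+1 (chain_weight p 1)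
      (Composition muP : composition (sumn mu).+1.-1) isT.
    by move=> /= ->; rewrite mulrC divfK // pnatr_eq0.
  - move=> n n0; have nP : is_composition n [:: n].
      by rewrite /is_composition /= n0 addn0 /=.
    by rewrite -(CE n (Composition nP)) // C1.
by move=> n l n1; rewrite CE // -pE //; have /andP[] := partsP l.
Qed.

(** * Words and their block sizes *)

Fixpoint words (al : seq nat) (n : nat) : seq (seq nat) :=
  if n is n'.+1 then [seq a :: w | a <- al, w <- words al n'] else [:: [::]].

Lemma mem_words al n w : (w \in words al n) = (size w == n) && all (mem al) w.
Proof.
elim: n w => [|n IH] w /=; first by rewrite inE; case: w.
apply/allpairsP/idP => [[[a u] /= [aal + ->]]|].
  by rewrite IH /= => /andP[/eqP -> ->]; rewrite eqxx aal.
case: w => //= a w /andP[]; rewrite eqSS => wn /andP[aal wal].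
by exists (a, w); rewrite /= IH wn wal.
Qed.

Lemma words_uniq al n : uniq al -> uniq (words al n).
Proof.
move=> al_uniq; elim: n => //= n IH; apply: allpairs_uniq => //.
by move=> [a w] [a' w'] _ _ /= [-> ->].
Qed.

Lemma block_sizes_peel a w : perm_eq (block_sizes w)
  ((if (0 < count_mem a w)%N then [:: count_mem a w] else [::]) ++
    block_sizes (seq.filter (predC1 a) w)).
Proof.
have cnt b : b != a -> count_mem b (seq.filter (predC1 a) w) = count_mem b w.
  move=> ba; rewrite count_filter; apply: eq_count => c /=.
  by case: eqP => // ->.
have -> : block_sizes (seq.filter (predC1 a) w) =
    [seq count_mem b w | b <- undup (seq.filter (predC1 a) w)].
  apply/eq_in_map => b; rewrite mem_undup mem_filter /= => /andP[ba _].
  exact: cnt.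
have -> : (if (0 < count_mem a w)%N then [:: count_mem a w] else [::]) =
    [seq count_mem b w | b <- if a \in w then [:: a] else [::]].
  by rewrite -has_count has_pred1; case: ifP.
rewrite -map_cat; apply: perm_map; apply: uniq_perm; first exact: undup_uniq.
  rewrite cat_uniq undup_uniq andbT; apply/andP; split; first by case: ifP.
  apply/hasPn => b; rewrite mem_undup mem_filter /= => /andP[ba _].
  by case: ifP => //; rewrite inE.
move=> b; rewrite mem_undup mem_cat mem_undup mem_filter /=.
have [->|ba] := eqVneq b a; last by case: ifP; rewrite ?inE ?(negbTE ba).
by case: ifP => _; rewrite ?inE ?eqxx.
Qed.

Section WordSums.
Variable R : realFieldType.
Implicit Types (v : nat -> R) (al w s : seq nat).

(** Words are grouped by the number [m] of occurrences of [a], whose positions can be chosen in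
    ['C(n, m)] ways. Induction on the first letter; its two cases are joined by Pascal's rule. *)
Lemma sum_words_peel v a al n (f : nat -> seq nat -> R) : a \notin al ->
  \sum_(w <- words (a :: al) n)
    f (count_mem a w) (seq.filter (predC1 a) w) * \prod_(b <- w) v b =
  \sum_(m < n.+1) 'C(n, m)%:R * v a ^+ m *
    \sum_(w <- words al (n - m)) f m w * \prod_(b <- w) v b.
Proof.
move=> a_al; elim: n f => [|n IH] f.
  by rewrite big_ord1 /= !big_seq1 /= !big_nil bin0 expr0 !mul1r.
pose S m k := \sum_(w <- words al k) f m w * \prod_(b <- w) v b.
rewrite /= big_cat big_map /=.
have -> : \sum_(w <- words (a :: al) n)
      f ((a == a) + count_mem a w)%N
        (if ~~ (a == a) then a :: seq.filter (predC1 a) w else seq.filter (predC1 a) w)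
      * \prod_(b <- a :: w) v b =
    \sum_(m < n.+1) 'C(n, m)%:R * v a ^+ m.+1 * S m.+1 (n - m)%N.
  rewrite eqxx /=.
  under eq_bigr => w _ do rewrite big_cons mulrCA.
  rewrite -mulr_sumr (IH (fun m => f m.+1)) mulr_sumr.
  by apply: eq_bigr => m _; rewrite exprS /S; ring.
have -> : \sum_(w <- [seq b :: w | b <- al, w <- words (a :: al) n])
      f (count_mem a w) (seq.filter (predC1 a) w) * \prod_(b <- w) v b =
    \sum_(m < n.+1) 'C(n, m)%:R * v a ^+ m * S m (n - m).+1.
  rewrite big_allpairs_dep /=.
  transitivity (\sum_(b <- al) \sum_(m < n.+1) 'C(n, m)%:R * v a ^+ m *
      \sum_(w <- words al (n - m)) f m (b :: w) * \prod_(b' <- b :: w) v b').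
    apply: eq_big_seq => b bal.
    have ba : b != a by apply: contraNneq a_al => <-.
    under eq_bigr => w _ do rewrite /= ba (negbTE ba) add0n big_cons mulrCA.
    rewrite -mulr_sumr (IH (fun m w => f m (b :: w))) mulr_sumr.
    apply: eq_bigr => m _; rewrite mulrCA; congr (_ * _).
    by rewrite mulr_sumr; apply: eq_bigr => w _; rewrite big_cons mulrCA.
  rewrite exchange_big; apply: eq_bigr => m _ /=.
  by rewrite -mulr_sumr /S /= big_allpairs_dep.
rewrite -/(S _ _) [RHS]big_ord_recl bin0 expr0 !mul1r subn0 -/(S _ _).
under [X in _ = _ + X]eq_bigr => m _.
  rewrite lift0 binS natrD subSS -/(S _ _) !mulrDl; over.
rewrite big_split /= addrA [RHS]addrC; congr (_ + _).
rewrite big_ord_recl bin0 expr0 !mul1r subn0; congr (_ + _).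
rewrite [RHS]big_ord_recr /= bin_small // !mul0r addr0.
apply: eq_bigr => m _; have -> : bump 0 m = m.+1 by []; congr (_ * _ * S _ _).
by have := ltn_ord m; lia.
Qed.

(* The probability that independent labels with weights [v] on [al] split a
   sample of [sumn s] balls into blocks of sizes [s]. *)
Definition block_prob v al s : R :=
  \sum_(w <- words al (sumn s) | perm_eq (block_sizes w) s) \prod_(b <- w) v b.

Lemma block_prob_nil v s : all (leq 1) s -> block_prob v [::] s = (s == [::])%:R.
Proof.
case: s => [_|x s /andP[x0 _]]; rewrite /block_prob /=.
  by rewrite big_mkcond big_seq1 /= big_nil.
by case: x x0 => // x _; rewrite big_nil.
Qed.

Lemma block_prob_ge0 v al s : (forall b, 0 <= v b) -> 0 <= block_prob v al s.
Proof. by move=> v0; apply: sumr_ge0 => w _; apply: prodr_ge0. Qed.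

Lemma block_prob_scale v v' (c : R) al s : {in al, forall b, v' b = c * v b} ->
  block_prob v' al s = c ^+ sumn s * block_prob v al s.
Proof.
move=> v'E; rewrite /block_prob mulr_sumr big_seq_cond [RHS]big_seq_cond.
apply: eq_bigr => w; rewrite mem_words => /andP[/andP[/eqP <- wal] _].
elim: w wal => [|b w IH] /=; first by rewrite !big_nil mulr1.
by move=> /andP[bal /IH e]; rewrite !big_cons e v'E // exprS; ring.
Qed.

(** The block labelled [a] is empty or is one of the parts of [s]; any other size contributes
    nothing. *)
Lemma block_prob_cons v a al s : a \notin al -> all (leq 1) s ->
  block_prob v (a :: al) s = block_prob v al s +
    \sum_(x <- undup s) 'C(sumn s, x)%:R * v a ^+ x * block_prob v al (rem x s).
Proof.
move=> a_al s1; set n := sumn s.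
(* The condition on block sizes depends on the word only through the count of [a] and the remaining
   letters, as [sum_words_peel] demands. *)
pose f m u : R := (perm_eq ((if (0 < m)%N then [:: m] else [::]) ++ block_sizes u) s)%:R.
have -> : block_prob v (a :: al) s = \sum_(w <- words (a :: al) n)
    f (count_mem a w) (seq.filter (predC1 a) w) * \prod_(b <- w) v b.
  rewrite /block_prob big_mkcond; apply: eq_bigr => w _ /=.
  rewrite /f (permPl (block_sizes_peel a w)).
  by case: perm_eq; rewrite ?mul1r ?mul0r.
rewrite sum_words_peel // big_ord_recl bin0 expr0 !mul1r subn0; congr (_ + _).
  rewrite /block_prob [RHS]big_mkcond; apply: eq_bigr => w _ /=.
  by rewrite /f /=; case: perm_eq; rewrite ?mul1r ?mul0r.
pose F x := 'C(n, x)%:R * v a ^+ x * block_prob v al (rem x s).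
have le_n x : x \in s -> (0 < x <= n)%N.
  by move=> xs; rewrite (allP s1 x xs) /= /n -(sumn_rem xs) leq_addr.
transitivity (\sum_(m < n | m.+1 \in s) F m.+1).
  rewrite [RHS]big_mkcond; apply: eq_bigr => m _; rewrite lift0.
  case: ifP => ms.
    rewrite /F; congr (_ * _); rewrite /block_prob.
    have -> : sumn (rem m.+1 s) = (n - m.+1)%N by have := sumn_rem ms; rewrite -/n; lia.
    rewrite [RHS]big_mkcond; apply: eq_bigr => w _ /=; rewrite /f /=.
    rewrite (permPr (perm_to_rem ms)) perm_cons.
    by case: perm_eq; rewrite ?mul1r ?mul0r.
  rewrite big1 ?mulr0 // => w _; rewrite /f /=.
  case: (boolP (perm_eq _ _)) => [/perm_mem/(_ m.+1)|]; rewrite ?mul0r //.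
  by rewrite ms inE eqxx.
rewrite -(big_mkord (fun m => m.+1 \in s) (fun m => F m.+1)).
rewrite -(big_map succn (mem s) F) -big_filter; apply: perm_big.
apply: uniq_perm; rewrite ?undup_uniq ?filter_uniq //.
  by rewrite map_inj_uniq ?iota_uniq // => ? ? [].
move=> x; rewrite mem_filter mem_undup /=; apply: andb_idr => xs.
have /andP[x0 xn] := le_n x xs.
by apply/mapP; exists x.-1; rewrite ?prednK // mem_index_iota; lia.
Qed.

End WordSums.

(** * Moments of the beta law *)

Import HBNNSimple.

(** Extends an identity from sets to non-negative functions, by simple functions and monotone
    convergence. It serves twice: to integrate against a beta density, with [phi] the identity, and
    to turn independence from events into independence from functions of a stick. *)
Lemma ge0_integral_image d (T : measurableType d) d' (U : measurableType d')
    (R : realType) (m : {measure set T -> \bar R}) (mu : {measure set U -> \bar R})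
    (D : set T) (phi : T -> U) (g : T -> R) (c : R) :
  measurable D -> measurable_fun setT phi -> measurable_fun D g ->
  (forall x, D x -> 0 <= g x) ->
  (forall A, measurable A ->
    \int[m]_(x in D `&` phi @^-1` A) (g x)%:E = c%:E * mu A)%E ->
  forall f : U -> R, measurable_fun setT f -> (forall y, 0 <= f y) ->
  (\int[m]_(x in D) (g x * f (phi x))%:E = c%:E * \int[mu]_y (f y)%:E)%E.
Proof.
move=> mD mphi mg g0 gmu f mf f0.
have mgE : measurable_fun D (EFin \o g) by exact/measurable_EFinP.
have simple (h : {nnsfun U >-> R}) :
    (\int[m]_(x in D) (g x * h (phi x))%:E = c%:E * \int[mu]_y (h y)%:E)%E.
  have mi r : measurable (h @^-1` [set r]).
    by exact: (@measurable_funPTI _ _ _ _ h).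
  rewrite integralT_nnsfun sintegralE.
  transitivity (\int[m]_(x in D) (\sum_(r \in range h)
      ((g x)%:E * (r * \1_(h @^-1` [set r]) (phi x))%:E)))%E.
    apply: eq_integral => x _; rewrite (fimfunE h (phi x)) EFinM -fsumEFin //.
    by rewrite ge0_mule_fsumr // => r; exact: nnfun_muleindic_ge0.
  have mindic r : measurable_fun D (fun x => (r * \1_(h @^-1` [set r]) (phi x))%:E).
    apply/measurable_EFinP; apply: measurable_funM => //.
    apply: (measurableT_comp (measurable_indic _)) => //.
    by apply: measurable_funTS.
  rewrite ge0_integral_fsum //; last 2 first.
  - by move=> r; apply: emeasurable_funM.
  - move=> r x Dx; apply: mule_ge0; first by rewrite lee_fin g0.
    exact: nnfun_muleindic_ge0.
  rewrite ge0_mule_fsumr; last first.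
    move=> r; have [r0|r0] := leP 0 r; first by rewrite mule_ge0 // lee_fin.
    by rewrite preimage_nnfun0 // measure0 mule0.
  apply: eq_fsbigr => r rh.
  have r0 : 0 <= r by move: rh; rewrite inE => -[y _ <-].
  under eq_integral do rewrite EFinM muleCA.
  rewrite ge0_integralZl //; last 2 first.
  - apply: (emeasurable_funM mgE); apply/measurable_EFinP.
    apply: (measurableT_comp (measurable_indic _)) => //.
    by apply: measurable_funTS.
  - by move=> x Dx; rewrite mule_ge0 ?lee_fin ?g0.
  rewrite muleCA; congr (_ * _)%E; rewrite -gmu // integral_mkcondr.
  by apply: eq_integral => x _; rewrite epatch_indic.
have mfE : measurable_fun setT (EFin \o f) by exact/measurable_EFinP.
pose h := nnsfun_approx measurableT mfE.
have hcvg y : EFin \o h^~ y @ \oo --> (f y)%:E.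
  by apply: cvg_nnsfun_approx => // z _; rewrite lee_fin.
have hnd y : {homo (fun n => h n y) : a b / (a <= b)%N >-> a <= b}.
  by move=> a b ab; exact/lefP/nd_nnsfun_approx.
have lim1 : (\int[m]_(x in D) (g x * h n (phi x))%:E)%E @[n --> \oo] -->
    (\int[m]_(x in D) (g x * f (phi x))%:E)%E.
  have -> : (\int[m]_(x in D) (g x * f (phi x))%:E)%E =
      (\int[m]_(x in D) limn (fun n => (g x * h n (phi x))%:E))%E.
    apply: eq_integral => x _; apply/esym/cvg_lim => //.
    under eq_fun do rewrite EFinM.
    by rewrite EFinM; apply: cvgeZl => //; exact: hcvg.
  apply: cvg_monotone_convergence => //.
  - move=> n; apply/measurable_EFinP; apply: measurable_funM => //.
    by apply: measurable_funTS; apply: measurableT_comp.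
  - by move=> n x Dx; rewrite lee_fin mulr_ge0 // g0.
  - by move=> x Dx a b ab; rewrite lee_fin ler_wpM2l ?g0 // hnd.
have lim2 : (\int[mu]_y (h n y)%:E)%E @[n --> \oo] --> (\int[mu]_y (f y)%:E)%E.
  have -> : (\int[mu]_y (f y)%:E)%E = (\int[mu]_y limn (fun n => (h n y)%:E))%E.
    by apply: eq_integral => y _; apply/esym/cvg_lim => //; exact: hcvg.
  apply: cvg_monotone_convergence => //.
  - by move=> n; exact/measurable_EFinP.
  - by move=> n y _; rewrite lee_fin.
  - by move=> y _ a b ab; rewrite lee_fin hnd.
apply: (cvg_unique _ lim1) => //.
have -> : (fun n => \int[m]_(x in D) (g x * h n (phi x))%:E)%E =
    (fun n => c%:E * \int[mu]_y (h n y)%:E)%E by apply/funext => n; exact: simple.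
by apply: cvgeZl.
Qed.

(** * Integration by parts for the beta integrand *)

Section BetaIntegral.
Variable R : realType.
Local Notation leb := (@lebesgue_measure R).
Local Notation unit_itv := (`]0%R, 1%R[%classic : set R).

Definition beta_kernel (r s x : R) : R := x `^ r * (1 - x) `^ s.

Lemma beta_kernel_ge0 r s x : 0 <= beta_kernel r s x.
Proof. by rewrite mulr_ge0 // powR_ge0. Qed.

Lemma measurable_beta_kernel (D : set R) r s : measurable_fun D (beta_kernel r s).
Proof.
apply/measurable_funTS/measurable_funM; first exact: measurable_powR.
apply: (measurableT_comp (f := @powR R ^~ s) (g := fun x : R => 1 - x)).
  exact: measurable_powR.
exact: measurable_funB.
Qed.

Lemma is_derive_beta_kernel (r s x : R) : 0 < x < 1 ->
  is_derive x 1 (beta_kernel r s)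
    (r * beta_kernel (r - 1) s x - s * beta_kernel r (s - 1) x).
Proof.
move=> /andP[x0 x1].
have D1 : is_derive x 1 (@powR R ^~ r) (r * x `^ (r - 1)) by exact: is_derive1_powR.
have D0 : is_derive x 1 (fun y : R => 1 - y) (-1).
  rewrite -[-1]sub0r; apply: is_deriveB.
have D2 : is_derive x 1 ((@powR R ^~ s) \o (fun y => 1 - y))
    (s * (1 - x) `^ (s - 1) * -1).
  apply: is_derive1_comp; apply: is_derive1_powR; by rewrite subr_gt0.
have -> : beta_kernel r s = (@powR R ^~ r) * ((@powR R ^~ s) \o (fun y => 1 - y)) by [].
apply: is_derive_eq; rewrite /beta_kernel /=.
rewrite /GRing.scale /=; ring.
Qed.

(** Confined to a compact subinterval of ]0, 1[ because the integrands may blow up at its ends.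
    Boundary terms are placed so that both sides are sums of non-negative terms, ready for a limit
    in the extended reals. *)
Lemma beta_kernel_by_parts (p q a b : R) : 0 < p -> 0 < q -> 0 < a -> a < b -> b < 1 ->
  (\int[leb]_(x in `[a, b]) (p * beta_kernel (p - 1) q x)%:E + (beta_kernel p q a)%:E =
   \int[leb]_(x in `[a, b]) (q * beta_kernel p (q - 1) x)%:E + (beta_kernel p q b)%:E)%E.
Proof.
move=> p0 q0 a0 ab b1.
pose f1 x := p * beta_kernel (p - 1) q x; pose f2 x := q * beta_kernel p (q - 1) x.
have in01 x : x \in `[a, b] -> 0 < x < 1.
  by rewrite in_itv /= => /andP[ax xb]; rewrite (lt_le_trans a0 ax) (le_lt_trans xb b1).
have wc c r s : {within `[a, b], continuous (fun x => c * beta_kernel r s x)}.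
  apply: derivable_within_continuous => x /in01 x01.
  have D := is_derive_beta_kernel r s x01.
  by apply: derivableM => //; exact: (@ex_derive _ _ _ _ _ _ _ D).
have int c r s : leb.-integrable `[a, b] (EFin \o (fun x => c * beta_kernel r s x)).
  by apply: continuous_compact_integrable; [exact: segment_compact|exact: wc].
have FTC : (\int[leb]_(x in `[a, b]) (f1 x - f2 x)%:E =
    (beta_kernel p q b)%:E - (beta_kernel p q a)%:E)%E.
  apply: continuous_FTC2 => //.
  - apply: derivable_within_continuous => x /in01 x01.
    have D1 := is_derive_beta_kernel (p - 1) q x01.
    have D2 := is_derive_beta_kernel p (q - 1) x01.
    by apply: derivableB; apply: derivableM => //; exact: ex_derive.
  - have cont x : 0 < x < 1 -> {for x, continuous (beta_kernel p q)}.
      move=> x01; apply: differentiable_continuous; apply/derivable1_diffP.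
      exact: (@ex_derive _ _ _ _ _ _ _ (is_derive_beta_kernel p q x01)).
    split.
    + move=> x /subset_itv_oo_cc /in01 x01.
      exact: (@ex_derive _ _ _ _ _ _ _ (is_derive_beta_kernel p q x01)).
    + by apply: cvg_at_right_filter; apply: cont; rewrite a0 (lt_trans ab b1).
    + by apply: cvg_at_left_filter; apply: cont; rewrite b1 (lt_trans a0 ab).
  - move=> x /subset_itv_oo_cc /in01 x01; rewrite derive1E.
    by rewrite (@derive_val _ _ _ _ _ _ _ (is_derive_beta_kernel p q x01)).
have := FTC; under eq_integral do rewrite EFinB.
rewrite integralB_EFin //; [|exact: int|exact: int].
have fin1 : (\int[leb]_(x in `[a, b]) (f1 x)%:E)%E \is a fin_num.
  by apply: integrable_fin_num => //; exact: int.
have fin2 : (\int[leb]_(x in `[a, b]) (f2 x)%:E)%E \is a fin_num.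
  by apply: integrable_fin_num => //; exact: int.
rewrite -(fineK fin1) -(fineK fin2) -!EFinB -!EFinD => -[] e; congr EFin.
by move: e; set u := fine _; set v := fine _ => e; lra.
Qed.

Lemma beta_integral_by_parts (p q : R) : 0 < p -> 0 < q ->
  (\int[leb]_(x in unit_itv) (p * beta_kernel (p - 1) q x)%:E =
   \int[leb]_(x in unit_itv) (q * beta_kernel p (q - 1) x)%:E)%E.
Proof.
(* The shift by 3 gives [e n <= 1 / 3], so that [[e n, 1 - e n]] is never degenerate. *)
move=> p0 q0; pose e n : R := n.+3%:R^-1.
have e0 n : 0 < e n by rewrite invr_gt0.
have e_lt n : e n < 1 - e n.
  have : e n <= 3^-1 by rewrite lef_pV2 ?posrE // ler_nat.
  have : (3 : R)^-1 < 1 - 3^-1 by lra.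
  lra.
pose I n := `[e n, 1 - e n]%classic.
have I_nd : nondecreasing_seq I.
  move=> n n' nn'; apply/subsetPset => x; rewrite /I /= !in_itv /=.
  have : e n' <= e n by rewrite lef_pV2 ?posrE // ler_nat; lia.
  by move=> h /andP[h1 h2]; apply/andP; split; lra.
have I_union : \bigcup_n I n = unit_itv.
  apply/seteqP; split=> x /=; rewrite in_itv /=.
    move=> [n _]; rewrite /I /= in_itv /= => /andP[h1 h2].
    by have := e0 n; move=> ?; apply/andP; split; lra.
  move=> /andP[x0 x1]; pose y := Num.min x (1 - x).
  have y0 : 0 < y by rewrite lt_min x0 subr_gt0.
  have [n ny] : exists n, e n <= y.
    exists (Num.truncn y^-1); rewrite /e -[leRHS]invrK lef_pV2 ?posrE ?invr_gt0 //.
    have := truncnS_gt y^-1 => h; apply/ltW/(lt_le_trans h).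
    by rewrite ler_nat ltnS; exact: leqW (leqnSn _).
  exists n => //; rewrite /I /= in_itv /=.
  have [yx yx1] : y <= x /\ y <= 1 - x by rewrite /y !ge_min !lexx orbT.
  by apply/andP; split; lra.
have cvgI r s c : 0 < c ->
    (\int[leb]_(x in I n) (c * beta_kernel r s x)%:E)%E @[n --> \oo] -->
    (\int[leb]_(x in unit_itv) (c * beta_kernel r s x)%:E)%E.
  move=> c0; rewrite -I_union; apply: ge0_nondecreasing_set_cvg_integral => //.
  - by move=> n; exact: measurable_itv.
  - move=> n; apply/measurable_EFinP; apply: measurable_funM => //.
    exact: measurable_beta_kernel.
  - by move=> n x _; rewrite lee_fin mulr_ge0 ?beta_kernel_ge0 // ltW.
have e_cvg0 : e @ \oo --> (0 : R).
  have := @cvg_harmonic R; rewrite -(cvg_shiftn 2); apply: cvg_trans.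
  by apply: near_eq_cvg; near=> n; rewrite /e /= addn2.
have powR_e r : 0 < r -> e n `^ r @[n --> \oo] --> (0 : R).
  by move=> r0; move: (powR_cvg0 r0) => /cvg_at_rightP; apply; split.
have ends (r s : R) (u : nat -> R) : 0 < r -> 0 < s ->
    (forall n, beta_kernel r s (u n) <= e n `^ r) ->
    (beta_kernel r s (u n))%:E @[n --> \oo] --> 0%E.
  move=> r0 s0 ule; apply: cvg_EFin; first exact: nearW.
  apply: (@squeeze_cvgr _ _ _ _ (fun=> 0) (fun n => e n `^ r)).
  - by apply: nearW => n; rewrite ule beta_kernel_ge0.
  - exact: cvg_cst.
  - exact: powR_e.
have beta_sym r s x : beta_kernel r s (1 - x) = beta_kernel s r x.
  by rewrite /beta_kernel subKr mulrC.
have end_le r s n : 0 < s -> beta_kernel r s (e n) <= e n `^ r.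
  move=> s0; rewrite /beta_kernel ler_piMr ?powR_ge0 //.
  have e1 : 0 <= 1 - e n <= 1 by have := e0 n; have := e_lt n; move=> *; apply/andP; split; lra.
  have /andP[h0 h1] := e1.
  have : (1 - e n) `^ s <= 1 `^ s by apply: ge0_ler_powR; rewrite ?nnegrE // ltW.
  by rewrite powR1.
have lhs : (\int[leb]_(x in I n) (p * beta_kernel (p - 1) q x)%:E
      + (beta_kernel p q (e n))%:E)%E @[n --> \oo] -->
    (\int[leb]_(x in unit_itv) (p * beta_kernel (p - 1) q x)%:E)%E.
  rewrite -[X in _ --> X]adde0; apply: cvgeD.
  - apply: ge0_adde_def; rewrite inE //; apply: integral_ge0 => x _.
    by rewrite lee_fin mulr_ge0 ?beta_kernel_ge0 // ltW.
  - exact: cvgI.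
  - by apply: ends => // n; exact: end_le.
have rhs : (\int[leb]_(x in I n) (q * beta_kernel p (q - 1) x)%:E
      + (beta_kernel p q (1 - e n))%:E)%E @[n --> \oo] -->
    (\int[leb]_(x in unit_itv) (q * beta_kernel p (q - 1) x)%:E)%E.
  rewrite -[X in _ --> X]adde0; apply: cvgeD.
  - apply: ge0_adde_def; rewrite inE //; apply: integral_ge0 => x _.
    by rewrite lee_fin mulr_ge0 ?beta_kernel_ge0 // ltW.
  - exact: cvgI.
  - under eq_fun do rewrite beta_sym.
    by apply: ends => // n; exact: end_le.
apply: (cvg_unique _ lhs) => //.
have -> : (fun n => \int[leb]_(x in I n) (p * beta_kernel (p - 1) q x)%:E
      + (beta_kernel p q (e n))%:E)%E =
    (fun n => \int[leb]_(x in I n) (q * beta_kernel p (q - 1) x)%:E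
      + (beta_kernel p q (1 - e n))%:E)%E.
  apply/funext => n; apply: beta_kernel_by_parts => //.
  by have := e0 n; lra.
exact: rhs.
Unshelve. all: by end_near. Qed.

End BetaIntegral.

Section BetaMoments.
Variables (R : realType) (d : measure_display) (T : measurableType d)
  (P : probability T R).
Local Notation leb := (@lebesgue_measure R).
Local Notation unit_itv := (`]0%R, 1%R[%classic : set R).

(** The sticks lie in ]0, 1[ only almost surely; clipping makes the bounds of the stick algebra hold
    at every outcome. *)
Definition clip (r : R) : R := Num.max 0 (Num.min r 1).

Lemma clip_itv r : 0 <= clip r <= 1.
Proof. by rewrite /clip le_max lexx ge_max ler01 ge_min lexx orbT. Qed.

Lemma clip_id r : 0 < r < 1 -> clip r = r.
Proof. by move=> /andP[r0 r1]; rewrite /clip (min_idPl (ltW r1)) (max_idPr (ltW r0)). Qed.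

Definition clip_monomial (k l : nat) (r : R) : R := clip r ^+ k * (1 - clip r) ^+ l.

Lemma clip_monomial_itv k l r : 0 <= clip_monomial k l r <= 1.
Proof.
have /andP[c0 c1] := clip_itv r.
have c0' : 0 <= 1 - clip r by rewrite subr_ge0.
rewrite mulr_ge0 ?exprn_ge0 // mulr_ile1 ?exprn_ge0 ?exprn_ile1 //.
by rewrite gerBl.
Qed.

Lemma measurable_clip_monomial k l : measurable_fun setT (clip_monomial k l).
Proof.
have mclip : measurable_fun setT clip.
  by apply: measurable_maxr => //; apply: measurable_minr.
apply: measurable_funM; apply: measurable_funX => //.
exact: measurable_funB.
Qed.

Lemma integral_probability_cst1 : (\int[P]_w 1 = 1)%E.
Proof. by rewrite integral_cst // mul1e; exact: probability_setT. Qed.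

Lemma beta_law_itv a b (X : {RV P >-> R}) : has_beta_law a b X ->
  {ae P, forall w, 0 < X w < 1}.
Proof.
move=> lawX; exists (X @^-1` (~` unit_itv)); split.
- by apply: measurable_funPTI; apply: measurableC; exact: measurable_itv.
- have := lawX (~` unit_itv) (measurableC (measurable_itv _)).
  by rewrite setICl integral_set0.
- by move=> w /= h; rewrite in_itv.
Qed.

(** The moments satisfy [j (k+1) l + j k (l+1) = j k l] and, by parts, [(a + k) * j k (l+1) = (b +
    l) * j (k+1) l]. Together these give both one-step ratios, and [j 0 0 = 1] fixes the rest
    without any Gamma function. *)
Lemma beta_law_moment (a b : R) (X : {RV P >-> R}) (k l : nat) : 0 < a -> 0 < b ->
  has_beta_law a b X ->
  (\int[P]_w (clip_monomial k l (X w))%:E =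
   (rising a k * rising b l / rising (a + b) (k + l))%:E)%E.
Proof.
move=> a0 b0 lawX.
(* This constant is never evaluated: [j 0 0 = 1] holds because [P] is a probability. *)
pose c0 : R := \int[leb]_(y in unit_itv) beta_weight a b y.
have c0_ge0 : 0 <= c0.
  by apply: Rintegral_ge0 => y _; exact: beta_kernel_ge0.
pose J k l := (\int[P]_w (clip_monomial k l (X w))%:E)%E.
have JE k' l' : J k' l' = (\int[leb]_(x in unit_itv)
    (c0^-1 * beta_kernel (a + k'%:R - 1) (b + l'%:R - 1) x)%:E)%E.
  rewrite /J -(@ge0_integral_distribution _ _ _ _ _ P X
      (fun r => (clip_monomial k' l' r)%:E)); last 2 first.
  - by apply/measurable_EFinP; exact: measurable_clip_monomial.
  - by move=> r; rewrite lee_fin; have /andP[] := clip_monomial_itv k' l' r.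
  rewrite -[LHS]mul1e -(@ge0_integral_image _ _ _ _ R leb (distribution P X) unit_itv id
     (fun x => beta_weight a b x / c0) 1).
  - apply: eq_integral => x; rewrite inE /= in_itv /= => /andP[x0 x1]; congr EFin.
    rewrite /clip_monomial clip_id ?x0 // /beta_kernel /beta_weight.
    have x1' : 0 < 1 - x by rewrite subr_gt0.
    rewrite [a + _ - 1]addrAC [b + _ - 1]addrAC !powRD ?(lt0r_neq0 x0) ?(lt0r_neq0 x1') ?implybT //.
    by rewrite !powR_mulrn ?ltW //; ring.
  - exact: measurable_itv.
  - exact: measurable_id.
  - apply: measurable_funM => //; exact: measurable_beta_kernel.
  - by move=> x _; rewrite divr_ge0 // beta_kernel_ge0.
  - by move=> A mA; rewrite mul1e setIC; exact/esym/lawX.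
  - exact: measurable_clip_monomial.
  - by move=> r; have /andP[] := clip_monomial_itv k' l' r.
have mX k' l' : measurable_fun setT (fun w => (clip_monomial k' l' (X w))%:E).
  apply/measurable_EFinP; apply: (measurableT_comp (measurable_clip_monomial k' l')).
  exact: measurable_funPT.
have J_fin k' l' : J k' l' \is a fin_num.
  rewrite ge0_fin_numE; last first.
    by apply: integral_ge0 => w _; rewrite lee_fin; have /andP[] := clip_monomial_itv k' l' (X w).
  apply: (@le_lt_trans _ _ (\int[P]_w 1)%E); last first.
    by rewrite integral_probability_cst1 ltry.
  apply: ge0_le_integral => //.
  - by move=> w _; rewrite lee_fin; have /andP[] := clip_monomial_itv k' l' (X w).
  - by move=> w _; rewrite lee_fin; have /andP[] := clip_monomial_itv k' l' (X w).
pose j k l := fine (J k l).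
have jE k' l' : J k' l' = (j k' l')%:E by rewrite /j fineK.
have j00 : j 0%N 0%N = 1.
  rewrite /j /J (eq_integral (fun=> 1%E)); last by move=> w _; rewrite /clip_monomial mulr1.
  by rewrite integral_probability_cst1.
have jD k' l' : j k'.+1 l' + j k' l'.+1 = j k' l'.
  apply: EFin_inj; rewrite EFinD -!jE /J -ge0_integralD //.
  - by apply: eq_integral => w _; rewrite -EFinD; congr EFin; rewrite /clip_monomial !exprS; ring.
  - by move=> w _; rewrite lee_fin; have /andP[] := clip_monomial_itv k'.+1 l' (X w).
  - by move=> w _; rewrite lee_fin; have /andP[] := clip_monomial_itv k' l'.+1 (X w).
have ak k' : 0 < a + k'%:R by rewrite ltr_wpDr.
have bl l' : 0 < b + l'%:R by rewrite ltr_wpDr.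
have jparts k' l' : (a + k'%:R) * j k' l'.+1 = (b + l'%:R) * j k'.+1 l'.
  apply: EFin_inj; rewrite !EFinM -!jE !JE.
  have mk c r s : measurable_fun unit_itv (fun x => (c * beta_kernel r s x)%:E).
    by apply/measurable_EFinP; apply: measurable_funM => //; exact: measurable_beta_kernel.
  have pull c r s : 0 <= c -> (\int[leb]_(x in unit_itv) (c * beta_kernel r s x)%:E =
      c%:E * \int[leb]_(x in unit_itv) (beta_kernel r s x)%:E)%E.
    move=> c_ge0; under eq_integral do rewrite EFinM.
    rewrite ge0_integralZl //.
    - by apply/measurable_EFinP; exact: measurable_beta_kernel.
    - by move=> x _; rewrite lee_fin beta_kernel_ge0.
  have := beta_integral_by_parts (ak k') (bl l').
  rewrite !pull ?invr_ge0 // ?ltW //.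
  rewrite -[l'.+1%:R]natr1 -[k'.+1%:R]natr1 !addrA !addrK => e.
  by rewrite muleCA e muleCA.
have ab n : 0 < a + b + n%:R by rewrite ltr_wpDr // addr_gt0.
have jSl k' l' : j k' l'.+1 = j k' l' * ((b + l'%:R) / (a + b + (k' + l')%:R)).
  have := ab (k' + l')%N; rewrite natrD => ab0.
  have e1 := jD k' l'; have e2 := jparts k' l'.
  apply: (mulfI (lt0r_neq0 ab0)); rewrite -e1.
  rewrite [RHS]mulrC -!mulrA mulVf ?lt0r_neq0 // mulr1 [RHS]mulrC mulrDr -e2; ring.
have jSk k' l' : j k'.+1 l' = j k' l' * ((a + k'%:R) / (a + b + (k' + l')%:R)).
  have := ab (k' + l')%N; rewrite natrD => ab0.
  have e1 := jD k' l'; have e2 := jparts k' l'.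
  apply: (mulfI (lt0r_neq0 ab0)); rewrite -e1.
  rewrite [RHS]mulrC -!mulrA mulVf ?lt0r_neq0 // mulr1 [RHS]mulrC mulrDr e2; ring.
rewrite -/(J k l) jE; congr EFin; elim: l => [|l IHl].
  elim: k => [|k IHk]; first by rewrite j00 /rising !big_ord0 mul1r divr1.
  rewrite jSk IHk !addn0 !risingS /rising big_ord0 -!/(rising _ _).
  have r0 : rising (a + b) k != 0 by rewrite lt0r_neq0 // rising_gt0 // addr_gt0.
  by field; rewrite r0 lt0r_neq0.
rewrite jSl IHl addnS !risingS.
have r0 : rising (a + b) (k + l) != 0 by rewrite lt0r_neq0 // rising_gt0 // addr_gt0.
have kl0 : a + b + (k + l)%:R != 0 by rewrite lt0r_neq0.
move: kl0; rewrite natrD => kl0.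
by field; rewrite r0 kl0.
Qed.

End BetaMoments.

(** * Sampling from the stick-breaking weights *)

Section StickBreaking.
Variable R : realFieldType.
Implicit Types (x : nat -> R) (s : seq nat).

(* The weights left after the first [i] sticks have been discarded, relative to
   what remains. *)
Definition stick (i : nat) (x : nat -> R) (j : nat) : R :=
  \prod_(i <= k < j) (1 - x k) * x j.

Lemma stick_ge0 i x j : (forall k, 0 <= x k <= 1) -> 0 <= stick i x j.
Proof.
move=> x01; rewrite mulr_ge0 //; last by have /andP[] := x01 j.
by apply: prodr_ge0 => k _; rewrite subr_ge0; have /andP[] := x01 k.
Qed.

(** Beyond label [i], every weight is [1 - x i] times its weight in the next family, and homogeneity
    extracts this factor as a power. *)
Lemma stick_block_prob i x N s : all (leq 1) s ->
  block_prob (stick i x) (iota i N.+1) s =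
  (1 - x i) ^+ sumn s * block_prob (stick i.+1 x) (iota i.+1 N) s +
  \sum_(y <- undup s) 'C(sumn s, y)%:R *
    (x i ^+ y * (1 - x i) ^+ (sumn s - y)
      * block_prob (stick i.+1 x) (iota i.+1 N) (rem y s)).
Proof.
move=> s1; rewrite /= block_prob_cons //; last by rewrite mem_iota ltnn.
have scale u : block_prob (stick i x) (iota i.+1 N) u =
    (1 - x i) ^+ sumn u * block_prob (stick i.+1 x) (iota i.+1 N) u.
  apply: block_prob_scale => j; rewrite mem_iota => /andP[ij _].
  by rewrite /stick big_ltn // mulrA.
rewrite scale; congr (_ + _); apply: eq_big_seq => y; rewrite mem_undup => ys.
have -> : stick i x i = x i by rewrite /stick big_geq // mul1r.
rewrite scale (_ : sumn (rem y s) = sumn s - y)%N ?mulrA //.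
by have := sumn_rem ys; lia.
Qed.

Lemma block_prob_seq0 (v : nat -> R) al : block_prob v al [::] = 1.
Proof. by rewrite /block_prob /= big_mkcond big_seq1 /= big_nil. Qed.

Lemma partition_weight_seq0 (alpha theta : R) : partition_weight alpha theta [::] = 1.
Proof.
by rewrite /partition_weight /symmetry_factor /new_block_prod /rising /= !big_nil
  !big_ord0 !mulr1 divr1.
Qed.

End StickBreaking.

Lemma measurable_stick d (T : measurableType d) (R : realType) (Y : nat -> T -> R) i j :
  (forall k, measurable_fun setT (Y k)) ->
  measurable_fun setT (fun w => stick i (Y ^~ w) j).
Proof.
move=> mY; apply: measurable_funM => //; apply: measurable_prod => k _.
exact: measurable_funB.
Qed.

Lemma measurable_clip_RV d (T : measurableType d) (R : realType)
    (P : probability T R) (V : {RV P >-> R}) : measurable_fun setT (fun w => clip (V w)).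
Proof.
have -> : (fun w => clip (V w)) = (fun w => clip_monomial 1 0 (V w)).
  by apply/funext => w; rewrite /clip_monomial expr1 expr0 mulr1.
exact: (measurableT_comp (measurable_clip_monomial 1 0) (measurable_funPT V)).
Qed.

(** * Expectations over independent sticks, one stick at a time *)

Section IndependentSticks.
Variables (R : realType) (d : measure_display) (T : measurableType d)
  (P : probability T R) (W : nat -> {RV P >-> R}).
Hypothesis W_indep : mutually_independent W.

Let cyl (J : {fset nat}) (A : nat -> set R) : set T :=
  \bigcap_(k in [set` J]) (W k @^-1` A k).

(* [Y] behaves like a [0, 1]-valued function of the variables before [W i]. *)
Definition past (i : nat) (Y : T -> R) : Prop :=
  [/\ measurable_fun setT Y, forall w, 0 <= Y w <= 1 &
    forall (J : {fset nat}) (A : nat -> set R), (forall k, measurable (A k)) ->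
      (forall k, k \in J -> (i <= k)%N) ->
      (\int[P]_(w in \bigcap_(k in [set` J]) (W k @^-1` A k)) (Y w)%:E =
       \int[P]_w (Y w)%:E * P (\bigcap_(k in [set` J]) (W k @^-1` A k)))%E].

Let measurable_cyl J A : (forall k, measurable (A k)) -> measurable (cyl J A).
Proof.
move=> mA; apply: fin_bigcap_measurable; first exact: finite_fset.
by move=> k _; exact: measurable_funPTI.
Qed.

Lemma past_cst1 : past 0 (fun=> 1).
Proof.
split=> [|w|J A mA _]; [exact: measurable_cst|by rewrite ler01 lexx|].
rewrite integral_probability_cst1 integral_cst ?mul1e //.
exact: measurable_cyl.
Qed.

Lemma past_integral i Y : past i Y ->
  exists2 e : R, 0 <= e & (\int[P]_w (Y w)%:E = e%:E)%E.
Proof.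
move=> [mY Y01 _].
have Y_ge0 : (0 <= \int[P]_w (Y w)%:E)%E.
  by apply: integral_ge0 => w _; rewrite lee_fin; have /andP[] := Y01 w.
exists (fine (\int[P]_w (Y w)%:E)%E); first exact: fine_ge0.
rewrite fineK // ge0_fin_numE //; apply: (@le_lt_trans _ _ (\int[P]_w 1)%E).
  apply: ge0_le_integral => //.
  - by move=> w _; rewrite lee_fin; have /andP[] := Y01 w.
  - exact/measurable_EFinP.
  - by move=> w _; rewrite lee_fin; have /andP[] := Y01 w.
by rewrite integral_probability_cst1 ltry.
Qed.

(** Multiplying by a monomial in the current stick gives a past of the next index, with a factorised
    mean. This is how an induction over sticks can carry along the factors already extracted. *)
Lemma past_mul i Y k l : past i Y ->
  past i.+1 (fun w => Y w * clip_monomial k l (W i w)) /\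
  (\int[P]_w (Y w * clip_monomial k l (W i w))%:E =
   \int[P]_w (Y w)%:E * \int[P]_w (clip_monomial k l (W i w))%:E)%E.
Proof.
move=> [mY Y01 Ypast]; set f := clip_monomial k l.
have f01 r : 0 <= f r <= 1 by exact: clip_monomial_itv.
have mf : measurable_fun setT f by exact: measurable_clip_monomial.
have mfW : measurable_fun setT (fun w => f (W i w)).
  exact: (measurableT_comp mf (measurable_funPT (W i))).
have [EY _ EYE] := past_integral (And3 mY Y01 Ypast).
have cylM J A : (forall k, measurable (A k)) -> (forall k, k \in J -> (i < k)%N) ->
    (\int[P]_(w in cyl J A) (Y w * f (W i w))%:E =
     (\int[P]_w (Y w)%:E * P (cyl J A)) * \int[P]_w (f (W i w))%:E)%E.
  move=> mA iJ.
  have mJ := measurable_cyl J mA.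
  have PJ : P (cyl J A) \is a fin_num by rewrite fin_num_measure.
  rewrite EYE -(fineK PJ) -EFinM.
  rewrite -(@ge0_integral_distribution _ _ _ _ _ P (W i) (fun r => (f r)%:E)); last 2 first.
  - exact/measurable_EFinP.
  - by move=> r; rewrite lee_fin; have /andP[] := f01 r.
  apply: ge0_integral_image => //.
  - exact: measurable_funTS.
  - by move=> w _; have /andP[] := Y01 w.
  (* The event on [W i] is merged into the cylinder as one more coordinate; [J] holds only later
     indices, so the coordinate is free. *)
  - move=> B mB; pose A' k := if k == i then B else A k.
    have mA' k' : measurable (A' k') by rewrite /A'; case: ifP.
    have iNJ : i \notin J by apply/negP => /iJ; rewrite ltnn.
    have A'J k' : k' \in J -> A' k' = A k'.
      by move=> k'J; rewrite /A'; case: eqP => // ki; move: iNJ; rewrite -ki k'J.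
    have cylE : cyl J A `&` W i @^-1` B = cyl (i |` J)%fset A'.
      apply/seteqP; split=> w.
        move=> [h hB] k' /=; rewrite in_fset1U => /orP[/eqP ->|k'J].
          by rewrite /A' eqxx.
        by rewrite A'J //; exact: h.
      move=> h; split.
        by move=> k' /= k'J; have := h k'; rewrite /= in_fset1U k'J orbT A'J //; exact.
      by have := h i; rewrite /= in_fset1U eqxx /A' eqxx; exact.
    rewrite cylE Ypast //; last first.
      by move=> k'; rewrite in_fset1U => /orP[/eqP -> //|/iJ/ltnW].
    rewrite EYE EFinM (fineK PJ) -[RHS]muleA; congr (_ * _)%E.
    rewrite [P (cyl J A)]W_indep // W_indep // big_fsetU1 //= muleC.
    have -> : A' i = B by rewrite /A' eqxx.
    congr (_ * _)%E; apply: eq_big_seq => k' k'J.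
    by rewrite A'J.
  - by move=> r; have /andP[] := f01 r.
have cyl0 A : cyl fset0 A = setT.
  by apply/seteqP; split=> w // _ k' /=.
have main : (\int[P]_w (Y w * f (W i w))%:E =
   \int[P]_w (Y w)%:E * \int[P]_w (f (W i w))%:E)%E.
  have := cylM fset0 (fun=> setT) (fun=> measurableT); rewrite cyl0 => -> //.
  by rewrite [P setT]probability_setT mule1.
split=> //; split.
- exact: measurable_funM.
- move=> w; have /andP[y0 y1] := Y01 w; have /andP[g0 g1] := f01 (W i w).
  by rewrite mulr_ge0 // mulr_ile1.
- by move=> J A mA iJ; rewrite main [LHS]cylM // muleAC.
Qed.

Let X (w : T) (j : nat) : R := clip (W j w).

Let measurable_block_prob i al s :
  measurable_fun setT (fun w => block_prob (stick i (X w)) al s).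
Proof.
under eq_fun do rewrite /block_prob -big_filter.
apply: measurable_sum => u; apply: measurable_prod => b _.
apply: (@measurable_stick _ _ _ (fun j w => X w j)) => j.
exact: measurable_clip_RV.
Qed.

Variables (alpha theta : R).
Hypotheses (alpha_ge0 : 0 <= alpha) (alpha_lt1 : alpha < 1)
  (theta_gt : - alpha < theta)
  (W_beta : forall i, has_beta_law (1 - alpha) (theta + i.+1%:R * alpha) (W i)).

Let X_itv w j : 0 <= X w j <= 1. Proof. exact: clip_itv. Qed.

Let moment i k l : (\int[P]_w (clip_monomial k l (W i w))%:E =
  (beta_moment alpha (theta + i%:R * alpha) k l)%:E)%E.
Proof.
move: (alpha_ge0) (alpha_lt1) (theta_gt) => a0 a1 t0.
have i0 : 0 <= i%:R * alpha by rewrite mulr_ge0.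
have E : theta + i.+1%:R * alpha = theta + i%:R * alpha + alpha by rewrite -natr1; ring.
rewrite (beta_law_moment _ _ _ _ (W_beta i)); last by rewrite E; lra.
  rewrite /beta_moment E; congr (_ / rising _ _)%:E; ring.
by rewrite subr_gt0.
Qed.

(** In mean, the recursion over one stick has the same non-negative coefficients as
    [partition_weight_rec], so the inequality propagates from [N = 0], where the left side vanishes
    for non-empty [s]. Each discarded stick adds [alpha] to [theta]; [Y] holds the factors of the
    sticks already integrated. *)
Lemma stick_block_prob_le N i s Y : past i Y -> all (leq 1) s ->
  (\int[P]_w (Y w * block_prob (stick i (X w)) (iota i N) s)%:E <=
   \int[P]_w (Y w)%:E * (partition_weight alpha (theta + i%:R * alpha) s)%:E)%E.
Proof.
move: (alpha_ge0) (alpha_lt1) (theta_gt) => a0 a1 t0.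
elim: N i s Y => [|N IH] i s Y pastY s1; have [mY Y01 _] := pastY.
all: have [->|s0] := eqVneq s [::].
all: rewrite ?partition_weight_seq0 ?mule1.
- by under eq_integral do rewrite block_prob_seq0 mulr1.
- rewrite integral0_eq; last by move=> w _; rewrite block_prob_nil // (negbTE s0) mulr0.
  have i0 : 0 <= i%:R * alpha by rewrite mulr_ge0.
  rewrite mule_ge0 ?lee_fin ?partition_weight_ge0 //; last lra.
  by apply: integral_ge0 => w _; rewrite lee_fin; have /andP[] := Y01 w.
- by under eq_integral do rewrite block_prob_seq0 mulr1.
set n := sumn s; pose th := theta + i%:R * alpha.
have i0 : 0 <= i%:R * alpha by rewrite mulr_ge0.
have thE : theta + i.+1%:R * alpha = th + alpha by rewrite /th -natr1; ring.
have th_gt : - alpha < th by rewrite /th; lra.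
pose B u w := block_prob (stick i.+1 (X w)) (iota i.+1 N) u.
pose Z k l w := Y w * clip_monomial k l (W i w).
have Bge0 u w : 0 <= B u w by apply: block_prob_ge0 => b; exact: stick_ge0.
have Zge0 k l w : 0 <= Z k l w.
  by rewrite mulr_ge0 //; [have /andP[] := Y01 w|have /andP[] := clip_monomial_itv k l (W i w)].
have ZBge0 k l u w : 0 <= Z k l w * B u w by apply: mulr_ge0.
have mZB k l u : measurable_fun setT (fun w => (Z k l w * B u w)%:E).
  have [[mZ _ _] _] := past_mul k l pastY.
  by apply/measurable_EFinP/measurable_funM => //; exact: measurable_block_prob.
have [e e0 YE] := past_integral pastY.
have ZB_le k l u : all (leq 1) u -> (\int[P]_w (Z k l w * B u w)%:E <=
    (e * (beta_moment alpha th k l * partition_weight alpha (th + alpha) u))%:E)%E.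
  move=> u1; have [pastZ ZE] := past_mul k l pastY.
  apply: le_trans (IH i.+1 u _ pastZ u1) _.
  have -> : (\int[P]_w (Z k l w)%:E = (e * beta_moment alpha th k l)%:E)%E.
    by rewrite ZE YE moment -EFinM.
  by rewrite thE -EFinM -mulrA.
rewrite (eq_integral (fun w => ((Z 0%N n w * B s w)%:E + \sum_(y <- undup s)
    ('C(n, y)%:R)%:E * (Z y (n - y)%N w * B (rem y s) w)%:E)%E)); last first.
  move=> w _; rewrite stick_block_prob // -/n mulrDr EFinD; congr (_ + _)%E.
    by rewrite /Z /clip_monomial expr0 mul1r mulrA.
  rewrite mulr_sumr -sumEFin; apply: eq_bigr => y _.
  by rewrite /Z /clip_monomial -EFinM -!/(X w i); congr EFin; rewrite /B; ring.
rewrite ge0_integralD //; last 3 first.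
- by move=> w _; rewrite lee_fin.
- by move=> w _; apply: sume_ge0 => y _; apply: mule_ge0; rewrite lee_fin.
- by apply: emeasurable_sum => y; apply: measurable_funeM.
rewrite ge0_integral_sum //; last 2 first.
- by move=> y; apply: measurable_funeM.
- by move=> y w _; apply: mule_ge0; rewrite lee_fin.
rewrite YE -/th partition_weight_rec // -EFinM mulrDr EFinD.
apply: leeD; first exact: ZB_le.
rewrite mulr_sumr -sumEFin big_seq [leRHS]big_seq.
apply: lee_sum => y; rewrite mem_undup => ys.
rewrite ge0_integralZl //; last by move=> w _; rewrite lee_fin.
rewrite -mulrA mulrCA EFinM lee_wpmul2l ?lee_fin // ZB_le //.
by apply/allP => z /mem_rem; exact: (allP s1).
Qed.

End IndependentSticks.

(** * Block sizes of the sampled labels *)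

Lemma sumn_block_sizes u : sumn (block_sizes u) = size u.
Proof.
rewrite sumnE big_map -sum1_size -[RHS](sum_undup_count u (fun=> 1%N : nat)).
by apply: eq_bigr => b _; rewrite natn mulr1.
Qed.

Lemma block_sizes_gt0 u : all (leq 1) (block_sizes u).
Proof.
by apply/allP => _ /mapP[b + ->]; rewrite mem_undup -has_count has_pred1.
Qed.

Lemma ranked_eqP s t : reflect (ranked s = ranked t) (perm_eq s t).
Proof.
apply: perm_sortP => [x y|y x z|x y]; first exact: leq_total.
  by move=> xy yz; exact: leq_trans yz xy.
by rewrite andbC => /anti_leq.
Qed.

Lemma perm_ranked s : perm_eq (ranked s) s.
Proof. by rewrite /ranked perm_sort. Qed.

Section Sampling.
Variables (R : realType) (d : measure_display) (T : measurableType d)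
  (P : probability T R) (W : nat -> {RV P >-> R}) (L : nat -> {RV P >-> nat})
  (alpha theta : R).
Hypotheses (alpha_ge0 : 0 <= alpha) (alpha_lt1 : alpha < 1)
  (theta_gt : - alpha < theta) (W_indep : mutually_independent W)
  (W_beta : forall i, has_beta_law (1 - alpha) (theta + i.+1%:R * alpha) (W i))
  (L_sample : sampled_from (stick_breaking W) L).

Lemma prob_mem_seq (U : eqType) (f : T -> U) (us : seq U) :
  (forall u, measurable [set w | f w = u]) -> uniq us ->
  P [set w | f w \in us] = (\sum_(u <- us) P [set w | f w = u])%E.
Proof.
move=> mf; elim: us => [_|u us IH /= /andP[uus us_uniq]].
  by rewrite big_nil (_ : mkset _ = set0) ?measure0 //; apply/seteqP; split.
rewrite big_cons -IH //.
have mus : measurable [set w | f w \in us].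
  elim: (us) => [|u' us' IH'].
    by rewrite (_ : mkset _ = set0) //; apply/seteqP; split.
  rewrite (_ : mkset _ = [set w | f w = u'] `|` [set w | f w \in us']).
    exact: measurableU.
  apply/seteqP; split=> w /=; rewrite inE; first by case/orP => [/eqP ->|]; [left|right].
  by move=> [->|->]; rewrite ?eqxx ?orbT.
rewrite -measureU //.
  congr (P _); apply/seteqP; split=> w /=; rewrite inE.
    by case/orP => [/eqP ->|]; [left|right].
  by move=> [->|->]; rewrite ?eqxx ?orbT.
by apply/seteqP; split=> w //= [->]; rewrite (negbTE uus).
Qed.

Let word n w : seq nat := [seq L k w | k <- iota 0 n].

Let wordP n u w : size u = n ->
  word n w = u <-> forall k, (k < n)%N -> L k w = nth 0%N u k.
Proof.
move=> un; split=> [<- k kn|h].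
  by rewrite (nth_map 0%N) ?size_iota // nth_iota.
apply: (@eq_from_nth _ 0%N); rewrite size_map size_iota // => k kn.
by rewrite (nth_map 0%N) ?size_iota // nth_iota // h.
Qed.

Let measurable_word n u : measurable [set w | word n w = u].
Proof.
have [un|un] := eqVneq (size u) n; last first.
  rewrite (_ : mkset _ = set0) //; apply/seteqP; split=> w //= wu.
  by move/eqP: un; rewrite -wu size_map size_iota.
rewrite (_ : mkset _ = \bigcap_(k in `I_n) (L k @^-1` [set nth 0%N u k])); last first.
  by apply/seteqP; split=> w; rewrite /mkset wordP.
case: n {un} => [|n]; first by rewrite II0 bigcap_set0.
by apply: bigcap_measurable => [|k _]; [exists 0%N|exact: measurable_funPTI].
Qed.

(** Words form a countable type, so the event splits along the codes given by [pickle]. *)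
Let measurable_word_set n (A : set (seq nat)) : measurable [set w | A (word n w)].
Proof.
have -> : [set w | A (word n w)] =
    \bigcup_(k in [set: nat]) [set w | A (word n w) /\ choice.unpickle k = Some (word n w)].
  apply/seteqP; split=> w /=; last by move=> [k _ []].
  by move=> Aw; exists (choice.pickle (word n w)); rewrite ?choice.pickleK.
apply: bigcup_measurable => k _; case E : (choice.unpickle k) => [u|]; last first.
  by rewrite (_ : mkset _ = set0) //; apply/seteqP; split=> w //= [].
have [Au|nAu] := pselect (A u).
  rewrite (_ : mkset _ = [set w | word n w = u]) //.
  by apply/seteqP; split=> w /= => [[_ [->]]|->].
rewrite (_ : mkset _ = set0) //; apply/seteqP; split=> w //= [Aw [uw]].
by apply: nAu; rewrite uw.
Qed.

Let stickE : {ae P, forall w j, stick_breaking W j w = stick 0 (fun j => clip (W j w)) j}.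
Proof.
have : {ae P, forall w, forall j, 0 < W j w < 1}.
  by apply: ae_foralln => j; exact: beta_law_itv (W_beta j).
apply: filterS => w W01 j; rewrite /stick_breaking /stick big_mkord clip_id //.
by congr (_ * _); apply: eq_bigr => k _; rewrite clip_id.
Qed.

Let prob_word u : P [set w | word (size u) w = u] =
  (\int[P]_w (\prod_(b <- u) stick 0 (fun j => clip (W j w)) b)%:E)%E.
Proof.
have -> : [set w | word (size u) w = u] =
    setT `&` [set w | forall k, (k < size u)%N -> L k w = nth 0%N u k].
  by rewrite setTI; apply/seteqP; split=> w; rewrite /mkset wordP.
(* Conditioning on the whole space, seen as the complement of the empty set in the generated
   sigma-algebra. *)
rewrite L_sample; last first.
  by rewrite -(setD0 setT); apply: sigma_algebraCD; exact: sigma_algebra0.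
apply: ae_eq_integral => //.
- apply/measurable_EFinP; apply: measurable_prod => k _.
  have -> : stick_breaking W (nth 0%N u k) = fun w => stick 0 (fun j => W j w) (nth 0%N u k).
    by apply/funext => w; rewrite /stick_breaking /stick big_mkord.
  by apply: measurable_stick => j; exact: measurable_funPT.
- apply/measurable_EFinP; apply: measurable_prod => b _.
  by apply: (measurable_stick (Y := fun j w => clip (W j w))) => j; exact: measurable_clip_RV.
- apply: filterS stickE => w e _; congr EFin; rewrite (big_nth 0%N) big_mkord.
  by apply: eq_bigr => k _; rewrite e.
Qed.

(* Only samples whose labels are below [N] are counted, so that no infinite sum
   over labels appears. *)
Let prob_truncated N s : all (leq 1) s ->
  (P [set w | word (sumn s) w \in
      [seq u <- words (iota 0 N) (sumn s) | perm_eq (block_sizes u) s]] <=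
   (partition_weight alpha theta s)%:E)%E.
Proof.
move=> s1; rewrite prob_mem_seq //; last by rewrite filter_uniq // words_uniq // iota_uniq.
have clip01 w j : 0 <= clip (W j w) <= 1 by exact: clip_itv.
have -> : (\sum_(u <- [seq u <- words (iota 0 N) (sumn s) | perm_eq (block_sizes u) s])
    P [set w | word (sumn s) w = u])%E =
  (\int[P]_w (1 * block_prob (stick 0 (fun j => clip (W j w))) (iota 0 N) s)%:E)%E.
  under [RHS]eq_integral do rewrite mul1r /block_prob -big_filter -sumEFin.
  rewrite ge0_integral_sum //.
  - apply: eq_big_seq => u; rewrite mem_filter mem_words => /and3P[_ /eqP <- _].
    exact: prob_word.
  - move=> u; apply/measurable_EFinP; apply: measurable_prod => b _.
    by apply: (measurable_stick (Y := fun j w => clip (W j w))) => j; exact: measurable_clip_RV.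
  - by move=> u w _; rewrite lee_fin; apply: prodr_ge0 => b _; exact: stick_ge0.
have := stick_block_prob_le W_indep alpha_ge0 alpha_lt1 theta_gt W_beta N (past_cst1 W) s1.
by rewrite integral_probability_cst1 mul1e mul0r addr0.
Qed.

(** A finite word has all its labels below some [N], so the truncated events increase to the full
    one and their common bound passes to the limit. *)
Lemma sample_prob_le n s : all (leq 1) s -> sumn s = n ->
  (P [set w | ranked (block_sizes (word n w)) = ranked s] <=
   (partition_weight alpha theta s)%:E)%E.
Proof.
move=> s1 <-.
pose E N := [set w | word (sumn s) w \in
  [seq u <- words (iota 0 N) (sumn s) | perm_eq (block_sizes u) s]].
have mE N : measurable (E N).
  exact: (@measurable_word_set (sumn s) [set u | u \in _]).
have EE N w : E N w <-> perm_eq (block_sizes (word (sumn s) w)) s /\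
    all (fun b => b < N)%N (word (sumn s) w).
  rewrite /E /= mem_filter mem_words size_map size_iota eqxx /=.
  have -> : all (mem (iota 0 N)) (word (sumn s) w) =
      all (fun b => b < N)%N (word (sumn s) w).
    by apply: eq_all => b /=; rewrite mem_iota.
  by split => /andP.
have E_nd : nondecreasing_seq E.
  move=> N N' NN'; apply/subsetPset => w /EE[h /allP hN]; apply/EE; split=> //.
  by apply/allP => b /hN /leq_trans; exact.
have -> : [set w | ranked (block_sizes (word (sumn s) w)) = ranked s] = \bigcup_N E N.
  apply/seteqP; split=> w /=.
    move/ranked_eqP => h; exists (\max_(b <- word (sumn s) w) b).+1 => //; apply/EE.
    by split=> //; apply/allP => b bw; rewrite ltnS; exact: leq_bigmax_seq.
  by move=> [N _ /EE[h _]]; exact/ranked_eqP.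
have cvgE : P (E N) @[N --> \oo] --> P (\bigcup_N E N).
  exact: (nondecreasing_cvg_mu mE (bigcup_measurable (fun N _ => mE N)) E_nd).
rewrite -(cvg_lim _ cvgE) //; apply: lime_le; first by apply/cvg_ex; eexists; exact: cvgE.
by apply: nearW => N; exact: prob_truncated.
Qed.

(** At every outcome the labels are natural numbers, so the block sizes form a composition of [n]
    and its ranking is listed; the stick weights need not be summed. *)
Lemma sample_prob_sum n : (0 < n)%N ->
  (\sum_(lam <- undup [seq ranked l | l : composition n])
     P [set w | ranked (block_sizes (word n w)) = lam] = 1)%E.
Proof.
move=> n0; rewrite -prob_mem_seq ?undup_uniq //.
  rewrite -(@probability_setT _ _ _ P); congr (P _); apply/seteqP; split=> w // _ /=.
  rewrite mem_undup.
  have bP : is_composition n (block_sizes (word n w)).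
    by rewrite /is_composition block_sizes_gt0 sumn_block_sizes size_map size_iota /=.
  by apply/mapP; exists (Composition bP); rewrite ?mem_enum.
by move=> lam; exact: (@measurable_word_set n [set u | ranked (block_sizes u) = lam]).
Qed.

End Sampling.

(** * Comparison of the two laws on partitions *)

Lemma sum_ranked (R : realFieldType) n (f : seq nat -> R) (l0 : composition n) :
  \sum_(l : composition n | ranked l == ranked l0) f l =
  \sum_(t <- permutations (ranked l0)) f t.
Proof.
have /andP[l1 /eqP ln] := partsP l0.
rewrite -(@sum_count_composition _ n); last first.
  apply/allP => t; rewrite mem_permutations => tl.
  have {}tl : perm_eq t l0 by rewrite (permPl tl) perm_ranked.
  by rewrite /is_composition (perm_all _ tl) l1 (perm_sumn tl) ln /=.
rewrite big_mkcond; apply: eq_bigr => l _.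
rewrite count_uniq_mem ?permutations_uniq // mem_permutations.
rewrite (permPr (perm_ranked l0)).
have -> : (ranked l == ranked l0) = perm_eq l l0 by apply/eqP/ranked_eqP.
by case: perm_eq; rewrite ?mulr1 ?mulr0.
Qed.

Lemma ss_markov_pmf_ranked (R : realType) (alpha theta : R) n (l0 : composition n) :
  0 <= alpha -> alpha < 1 -> - alpha < theta -> (0 < n)%N ->
  \sum_(l : composition n | ranked l == ranked l0) ss_markov_pmf alpha theta l =
  partition_weight alpha theta (ranked l0).
Proof.
move=> a0 a1 t0 n0; have /andP[l1 /eqP ln] := partsP l0.
rewrite (sum_ranked (chain_weight (trans_prob alpha theta) 1)).
apply: sum_permutations_chain_weight => //; first by rewrite (perm_all _ (perm_ranked l0)).
by apply: contraTneq n0 => l_nil; rewrite -ln -(perm_sumn (perm_ranked l0)) l_nil.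
Qed.

Lemma eq_of_le_sum (R : realFieldType) (I : eqType) (r : seq I) (f g : I -> R) :
  {in r, forall i, f i <= g i} -> \sum_(i <- r) f i = \sum_(i <- r) g i ->
  {in r, f =1 g}.
Proof.
move=> fg e i ir; apply/esym/eqP; rewrite -subr_eq0.
have : \sum_(j <- r | j \in r) (g j - f j) == 0.
  by rewrite -big_seq sumrB e subrr.
rewrite psumr_eq0; last by move=> j jr; rewrite subr_ge0 fg.
by move=> /allP/(_ i ir); rewrite ir.
Qed.

Lemma ss_markov_pmf_arrangement (R : realType) (alpha theta : R)
    (pi : nat -> seq nat -> R) :
  0 <= alpha -> alpha < 1 -> - alpha < theta ->
  alpha_theta_partition_structure alpha theta pi ->
  is_arrangement pi (ss_markov_pmf alpha theta).
Proof.
move=> a0 a1 t0 [d [T [P [W [L [W_indep W_beta L_sample piE]]]]]].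
split; first exact: ss_markov_composition_structure.
move=> n n1; set S := undup [seq ranked l | l : composition n].
pose D lam := \sum_(l : composition n | ranked l == lam) ss_markov_pmf alpha theta l.
have pi_sum : \sum_(lam <- S) pi n lam = 1.
  apply: EFin_inj; rewrite -sumEFin -(sample_prob_sum L n1).
  by apply: eq_bigr => lam _; exact: piE.
have D_sum : \sum_(lam <- S) D lam = 1.
  rewrite -(ss_markov_pmf_sum a0 a1 t0 n1) /D.
  under eq_bigr do rewrite big_mkcond.
  rewrite exchange_big; apply: eq_bigr => l _ /=.
  have lS : ranked l \in S by rewrite mem_undup; apply/mapP; exists l; rewrite ?mem_enum.
  rewrite (bigD1_seq (ranked l)) ?undup_uniq //= eqxx big1 ?addr0 // => lam.
  by rewrite eq_sym => /negbTE ->.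
have pi_le : {in S, forall lam, pi n lam <= D lam}.
  move=> lam; rewrite mem_undup => /mapP[l _ ->].
  have /andP[l1 /eqP ln] := partsP l.
  rewrite /D ss_markov_pmf_ranked // -lee_fin piE //.
  have -> : [set w | ranked (block_sizes [seq L k w | k <- iota 0 n]) = ranked l] =
      [set w | ranked (block_sizes [seq L k w | k <- iota 0 n]) = ranked (ranked l)].
    by have /ranked_eqP -> := perm_ranked l.
  apply: (sample_prob_le a0 a1 t0 W_indep W_beta L_sample).
    by rewrite (perm_all _ (perm_ranked l)).
  by rewrite (perm_sumn (perm_ranked l)).
move=> lam; rewrite -/(D lam); have [lamS|lamS] := boolP (lam \in S).
  by apply/esym/(eq_of_le_sum pi_le) => //; rewrite pi_sum D_sum.
(* A sequence that is not the ranking of any composition of [n]: both sides vanish. *)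
have noS l : ranked (l : composition n) == lam = false.
  apply: contraNF lamS => /eqP <-.
  by rewrite mem_undup; apply/mapP; exists l; rewrite ?mem_enum.
rewrite /D big_pred0 //; apply: EFin_inj; rewrite piE // (_ : mkset _ = set0) ?measure0 //.
apply/seteqP; split=> w //= wlam.
have bP : is_composition n (block_sizes [seq L k w | k <- iota 0 n]).
  by rewrite /is_composition block_sizes_gt0 sumn_block_sizes size_map size_iota /=.
by have := noS (Composition bP); rewrite /= wlam eqxx.
Qed.

(** A one-part ranking comes from a single composition, so [pi] fixes its probability: exactly the
    data that the uniqueness argument starts from. *)
Lemma is_arrangement_one_part (R : realType) (pi : nat -> seq nat -> R)
    (C : forall n, composition n -> R) n (l : composition n) :
  is_arrangement pi C -> (1 <= n)%N -> l = [:: n] :> seq nat -> C n l = pi n [:: n].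
Proof.
move=> [_ CE] n1 lE; rewrite -CE // (big_pred1 l) // => l'.
apply/eqP/eqP => [l'E|->]; last by rewrite lE.
apply: val_inj; rewrite /= lE; apply: perm_small_eq => //.
by apply/ranked_eqP; rewrite l'E.
Qed.

Theorem corollary15 (R : realType) (alpha theta : R)
    (alpha_ge0 : 0 <= alpha) (alpha_lt1 : alpha < 1) (theta_gt : - alpha < theta)
    (pi : nat -> seq nat -> R)
    (pi_alpha_theta : alpha_theta_partition_structure alpha theta pi) :
  exists C : forall n : nat, composition n -> R,
    [/\ is_arrangement pi C,
        self_similar_markov C &
        forall C' : forall n : nat, composition n -> R,
          is_arrangement pi C' -> self_similar_markov C' ->
          forall n : nat, (1 <= n)%N -> forall l : composition n,
            C' n l = C n l].
Proof.
have C_arr := ss_markov_pmf_arrangement alpha_ge0 alpha_lt1 theta_gt pi_alpha_theta.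
exists (ss_markov_pmf alpha theta); split=> //; first exact: ss_markov_pmf_self_similar.
move=> C' C'_arr C'_ssm n n1 l.
apply: (self_similar_markov_unique alpha_ge0 alpha_lt1 theta_gt C'_ssm) => // m l' m1 l'E.
rewrite (is_arrangement_one_part C'_arr m1 l'E).
by rewrite (is_arrangement_one_part C_arr m1 l'E).
Qed.
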